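(* Let $\sigma>0$, $P\in\mathbb{R}^n$ and $H(p,x)=\frac{|p|^2}{2}+V(x)$ with $V$ smooth and $\mathbb{Z}^n$-periodic. Let $\overline{H}(P)$ be the unique real number for which $$-\frac{\sigma^2}{2}\Delta u+H(P+D_xu,x)=\overline{H}(P)$$ has a $\mathbb{Z}^n$-periodic viscosity solution. Then $\overline{H}(P)$ is the principal eigenvalue, with periodic boundary conditions, of the operator $$\mathcal{L}\psi=e^{\frac{P\cdot x}{\sigma^2}}\frac{\sigma^4}{2}\Delta\bigl(e^{-\frac{P\cdot x}{\sigma^2}}\psi\bigr)+V(x)\psi=\frac{\sigma^4}{2}\Delta\psi-\sigma^2P\cdot D_x\psi+\Bigl(V(x)+\frac{|P|^2}{2}\Bigr)\psi .$$
   Context: The principal eigenvalue of $\mathcal{L}$ with periodic boundary conditions is the eigenvalue possessing a positive $\mathbb{Z}^n$-periodic eigenfunction (unique up to scaling): $\mathcal{L}\varphi=\lambda\varphi$, $\varphi>0$. *)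

(* Defs.v *)
From mathcomp Require Import all_boot all_order all_algebra.
From mathcomp Require Import all_classical all_reals all_analysis.

Set Implicit Arguments.
Unset Strict Implicit.
Unset Printing Implicit Defensive.

Import Order.TTheory GRing.Theory Num.Theory.
Import numFieldNormedType.Exports.

Local Open Scope classical_set_scope.
Local Open Scope ring_scope.

Section Calculus.
Context {R : realType} {n : nat}.
Implicit Types (f : 'rV[R]_n -> R) (p q x : 'rV[R]_n).

(* The library norm on 'rV[R]_n is the sup norm, so the Euclidean |p|^2 is
   written dot p p. *)
Definition dot p q : R := \sum_(i < n) p 0 i * q 0 i.

Definition partial (i : 'I_n) f : 'rV[R]_n -> R :=
  fun x => 'D_(delta_mx 0 i) f x.

Definition grad f x : 'rV[R]_n := \row_i partial i f x.

Definition hessian f x : 'M[R]_n := \matrix_(i, j) partial i (partial j f) x.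

Definition laplacian f x : R := \tr (hessian f x).

(* 'D_v f x is a total operator with a junk value where the limit does not
   exist, so derivability has to be asserted separately. *)
Fixpoint Ck (k : nat) f : Prop :=
  continuous f /\
  if k is k'.+1 then
    forall i, (forall x, derivable f x (delta_mx 0 i)) /\ Ck k' (partial i f)
  else True.

Definition smooth f : Prop := forall k, Ck k f.

Definition Zperiodic f : Prop :=
  forall (m : 'rV[int]_n) x, f (x + map_mx intr m) = f x.

End Calculus.

Section Viscosity.
Context {R : realType} {n : nat}.
Implicit Types (F : 'rV[R]_n -> 'M[R]_n -> 'rV[R]_n -> R) (u : 'rV[R]_n -> R).

(* Equations F(Du, D^2 u, x) = 0, with F nonincreasing in the Hessian. *)
Definition viscosity_subsolution F u : Prop :=
  forall (phi : 'rV[R]_n -> R) x0, Ck 2 phi ->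
    (\forall y \near x0, u y - phi y <= u x0 - phi x0) ->
    F (grad phi x0) (hessian phi x0) x0 <= 0.

Definition viscosity_supersolution F u : Prop :=
  forall (phi : 'rV[R]_n -> R) x0, Ck 2 phi ->
    (\forall y \near x0, u x0 - phi x0 <= u y - phi y) ->
    0 <= F (grad phi x0) (hessian phi x0) x0.

Definition viscosity_solution F u : Prop :=
  [/\ continuous u, viscosity_subsolution F u & viscosity_supersolution F u].

End Viscosity.

Section Problem.
Context {R : realType} {n : nat}.
Implicit Types (sigma : R) (P p x : 'rV[R]_n) (V psi : 'rV[R]_n -> R).

Definition hamiltonian V p x : R := dot p p / 2 + V x.

Definition cell_equation sigma P (H : 'rV[R]_n -> 'rV[R]_n -> R) (c : R)
    (p : 'rV[R]_n) (X : 'M[R]_n) x : R :=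
  - (sigma ^+ 2 / 2) * \tr X + H (P + p) x - c.

Definition is_effective_hamiltonian sigma P
    (H : 'rV[R]_n -> 'rV[R]_n -> R) (Hbar : R) : Prop :=
  unique (fun c => exists u : 'rV[R]_n -> R,
    Zperiodic u /\ viscosity_solution (cell_equation sigma P H c) u) Hbar.

Definition twisted_operator sigma P V psi x : R :=
  expR (dot P x / sigma ^+ 2) * (sigma ^+ 4 / 2) *
    laplacian (fun y => expR (- (dot P y / sigma ^+ 2)) * psi y) x
  + V x * psi x.

Definition positive_eigenfunction (L : ('rV[R]_n -> R) -> 'rV[R]_n -> R)
    (lambda : R) (phi : 'rV[R]_n -> R) : Prop :=
  [/\ Ck 2 phi, Zperiodic phi, forall x, 0 < phi x
    & forall x, L phi x = lambda * phi x].

Definition is_principal_eigenvalue (L : ('rV[R]_n -> R) -> 'rV[R]_n -> R)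
    (lambda : R) : Prop :=
  unique (fun mu => exists phi, positive_eigenfunction L mu phi) lambda /\
  forall phi psi, positive_eigenfunction L lambda phi ->
    positive_eigenfunction L lambda psi ->
    exists a : R, forall x, psi x = a * phi x.

End Problem.

(* Main.v *)
Require Import Defs.
From mathcomp Require Import all_boot all_order all_algebra.
From mathcomp Require Import all_classical all_reals all_analysis.
From mathcomp Require Import ring lra.

Import Order.TTheory GRing.Theory Num.Theory.
Import numFieldNormedType.Exports.

Local Open Scope classical_set_scope.
Local Open Scope ring_scope.

(** The Hopf-Cole substitution u = - sigma^2 ln phi turns the cell equation into
    L phi = c phi, so a positive C^2 eigenfunction is a classical, hence viscosity,
    solution, and uniqueness of the effective Hamiltonian gives uniqueness of the
    eigenvalue.  Conversely, let u be a viscosity solution, phi = exp (- u / sigma^2), and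
    A w = k w - (sigma^4 / 2) Lap w + sigma^2 P . grad w.  For k large, phi should solve
    A phi = g with g = (k + V + |P|^2 / 2 - c) phi > 0.  The equation A w = h is solved
    explicitly for trigonometric polynomials h, which are dense (Fejer kernels); for h
    close to g, the function - sigma^2 ln w is a test function for u at the extrema of
    w / phi, and this forces w to be uniformly close to phi.  A doubling of variables
    bounds grad w by the sup norm of A w, so phi is C^1; then g is C^1, the argument
    applies to the difference quotients of phi, and phi is C^2.  Simplicity of the
    eigenvalue follows from the strong minimum principle for psi - (min psi / phi) phi. *)

Set Implicit Arguments.
Unset Strict Implicit.
Unset Printing Implicit Defensive.

(** * Functions of class C^k *)

(** In general a continuous right-hand side does not make a solution of A w = g of class C^2, so
    there is no bound of second derivatives by sup |A w|: each use of the gradient bound gains a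
    single derivative. Two passes suffice because g has phi as a factor, so the first pass makes g
    itself C^1. The second pass runs on difference quotients, which works because A has constant
    coefficients and commutes with translations; this is why V is moved to the right-hand side. No
    two viscosity solutions are ever compared: one of the two functions is always a C^2 function w.
    The term k w serves twice. It gives A a maximum principle, and it makes k + V + |P|^2 / 2 - c at
    least 1, so that at an extremum of w / phi an error in g controls w - phi. Positivity of w,
    required by the logarithm, comes from the same maximum principle, since g >= min phi > 0. *)

Section Lines.
Context {R : realType} {W : normedModType R}.
Implicit Types (f g : W -> R) (x y v : W).

(** Both difference quotients are the same function of [h]; one-variable theorems thereby apply to
    directional derivatives. *)
Lemma is_derive_line f x v (t d : R) :
  is_derive t 1 (fun h : R => f (h *: v + x)) d <-> is_derive (t *: v + x) v f d.
Proof.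
have E : (fun h : R => h^-1 *: (((fun h : R => f (h *: v + x)) \o shift t) (h *: 1)
     - f (t *: v + x))) =
   (fun h : R => h^-1 *: ((f \o shift (t *: v + x)) (h *: v) - f (t *: v + x))).
  by apply/funext => h /=; rewrite [_%:A]mulr1 scalerDl addrA.
by split=> -[h1 h2]; split; move: h1 h2; rewrite /derivable /derive E.
Qed.

Lemma is_derive_line0 f x v (d : R) :
  is_derive (0 : R) 1 (fun h : R => f (h *: v + x)) d <-> is_derive x v f d.
Proof. by rewrite is_derive_line scale0r add0r. Qed.

(** On the line through [x] this is the one-variable chain rule, so a derivative of [f] along [v]
    suffices, without differentiability. *)
Lemma is_derive_comp (F : R -> R) f x v (dF df : R) :
  is_derive (f x) 1 F dF -> is_derive x v f df ->
  is_derive x v (fun y => F (f y)) (dF * df).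
Proof.
move=> dF1 /is_derive_line0 df1; apply/is_derive_line0.
pose l (h : R) := f (h *: v + x).
have l0 : f x = l 0 by rewrite /l scale0r add0r.
rewrite l0 in dF1; have [dl El] := df1; have [dF2 EF] := dF1.
have dc : derivable (F \o l) 0 1.
  by apply/derivable1_diffP/differentiable_comp; apply/derivable1_diffP.
split; first exact: dc.
have := derive1_comp dl dF2; rewrite !derive1E EF => ->.
by congr (_ * _).
Qed.

End Lines.

Section CkTheory.
Context {R : realType} {n : nat}.
Implicit Types (f g : 'rV[R]_n -> R) (x y v : 'rV[R]_n) (k : nat) (i j : 'I_n).

Lemma Ck_continuous k f : Ck k f -> continuous f.
Proof. by case: k => [|k] []. Qed.

Lemma Ck_derivable k f : Ck k.+1 f -> forall i x, derivable f x (delta_mx 0 i).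
Proof. by move=> [_ h] i x; case: (h i). Qed.

Lemma Ck_is_derive k f : Ck k.+1 f ->
  forall i x, is_derive x (delta_mx 0 i) f (partial i f x).
Proof. by move=> h i x; apply: derivableP; exact: Ck_derivable h _ _. Qed.

Lemma Ck_partial k f : Ck k.+1 f -> forall i, Ck k (partial i f).
Proof. by move=> [_ h] i; case: (h i). Qed.

(** Introduction rule behind the closure lemmas below: each one supplies candidate partial
    derivatives and proceeds by induction on [k]. *)
Lemma CkS k f (df : 'I_n -> 'rV[R]_n -> R) : continuous f ->
  (forall i x, is_derive x (delta_mx 0 i) f (df i x)) ->
  (forall i, Ck k (df i)) -> Ck k.+1 f.
Proof.
move=> cf df1 Ckdf; split=> // i; split=> [x|]; first by case: (df1 i x).
rewrite (_ : partial i f = df i)//; apply/funext => x.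
by case: (df1 i x).
Qed.

Lemma partial_eq f i x d : is_derive x (delta_mx 0 i) f d -> partial i f x = d.
Proof. by case. Qed.

Lemma CkW k f : Ck k.+1 f -> Ck k f.
Proof.
elim: k f => [|k IH] f; first by case.
move=> h; apply: (@CkS _ _ (fun i => partial i f)).
- exact: Ck_continuous h.
- by move=> i x; exact: Ck_is_derive h i x.
- by move=> i; apply: IH; exact: Ck_partial h i.
Qed.

Lemma Ck_le k l f : (k <= l)%N -> Ck l f -> Ck k f.
Proof.
elim: l => [|l IH]; first by rewrite leqn0 => /eqP->.
rewrite leq_eqVlt => /predU1P[->//|kl] h.
by apply: IH => //; exact: CkW.
Qed.

Lemma Ck_cst k (c : R) : Ck k (fun _ : 'rV[R]_n => c).
Proof.
elim: k c => [|k IH] c; first by split=> // x; exact: cst_continuous.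
apply: (@CkS _ _ (fun _ _ => 0)).
- by move=> x; exact: cst_continuous.
- by move=> _; exact: IH.
Qed.

Lemma Ck_add k f g : Ck k f -> Ck k g -> Ck k (fun x => f x + g x).
Proof.
elim: k f g => [|k IH] f g hf hg.
  split=> // x; apply: continuousD; [exact: Ck_continuous hf _|exact: Ck_continuous hg _].
apply: (@CkS _ _ (fun i x => partial i f x + partial i g x)).
- move=> x; apply: continuousD; [exact: Ck_continuous hf _|exact: Ck_continuous hg _].
- move=> i x; apply: is_deriveD; [exact: Ck_is_derive hf _ _|exact: Ck_is_derive hg _ _].
- move=> i; apply: IH; exact: Ck_partial.
Qed.

Lemma Ck_mul k f g : Ck k f -> Ck k g -> Ck k (fun x => f x * g x).
Proof.
elim: k f g => [|k IH] f g hf hg.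
  split=> // x; apply: continuousM; [exact: Ck_continuous hf _|exact: Ck_continuous hg _].
apply: (@CkS _ _ (fun i x => f x * partial i g x + g x * partial i f x)).
- move=> x; apply: continuousM; [exact: Ck_continuous hf _|exact: Ck_continuous hg _].
- move=> i x; apply: is_deriveM; [exact: Ck_is_derive hf _ _|exact: Ck_is_derive hg _ _].
- move=> i; apply: Ck_add; apply: IH => //; do ? [exact: CkW|exact: Ck_partial].
Qed.

Lemma Ck_scale k (c : R) f : Ck k f -> Ck k (fun x => c * f x).
Proof. exact/Ck_mul/Ck_cst. Qed.

Lemma Ck_opp k f : Ck k f -> Ck k (fun x => - f x).
Proof.
move=> /(Ck_scale (-1)); congr Ck; by apply/funext => x; rewrite mulN1r.
Qed.

Lemma Ck_sub k f g : Ck k f -> Ck k g -> Ck k (fun x => f x - g x).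
Proof. by move=> hf hg; apply: Ck_add => //; exact: Ck_opp. Qed.

Lemma Ck_sum k (I : Type) (s : seq I) (F : I -> 'rV[R]_n -> R) :
  (forall l, Ck k (F l)) -> Ck k (fun x => \sum_(l <- s) F l x).
Proof.
move=> h; elim: s => [|l s IH].
  rewrite (_ : (fun _ => _) = fun=> 0); first exact: Ck_cst.
  by apply/funext => x; rewrite big_nil.
rewrite (_ : (fun _ => _) = fun x => F l x + \sum_(l <- s) F l x).
  exact: Ck_add.
by apply/funext => x; rewrite big_cons.
Qed.

Lemma is_derive_coord i j x : is_derive x (delta_mx 0 j) (fun y => y 0 i) (i == j)%:R.
Proof.
apply/is_derive_line0.
rewrite (_ : (fun _ => _) = fun h : R => h * (i == j)%:R + x 0 i); last first.
  by apply/funext => t; rewrite !mxE eqxx.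
apply: is_derive_eq.
by rewrite addr0 scaler0 add0r [_%:A]mulr1.
Qed.

Lemma Ck_coord k i : Ck k (fun x : 'rV[R]_n => x 0 i).
Proof.
have h : continuous (fun x : 'rV[R]_n => x 0 i) by exact: coord_continuous.
case: k => [//|k].
apply: (@CkS _ _ (fun j _ => (i == j)%:R)) => //.
- by move=> j x; exact: is_derive_coord.
- by move=> j; exact: Ck_cst.
Qed.

Lemma Ck_dot k (p : 'rV[R]_n) : Ck k (fun x => dot p x).
Proof. by apply: Ck_sum => i; apply: Ck_scale; exact: Ck_coord. Qed.

Lemma is_derive_dot (p : 'rV[R]_n) i x : is_derive x (delta_mx 0 i) (dot p) (p 0 i).
Proof.
apply/is_derive_line0.
rewrite (_ : (fun _ => _) = fun h : R => h * p 0 i + dot p x).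
  by apply: is_derive_eq; rewrite addr0 scaler0 add0r [_%:A]mulr1.
apply/funext => h; rewrite /dot.
under eq_bigr => j _ do rewrite !mxE eqxx mulrDr mulrCA.
rewrite big_split /= -mulr_sumr; congr (_ * _ + _).
rewrite (bigD1 i) //= eqxx mulr1 big1 ?addr0 // => j ji.
by rewrite (negbTE ji) mulr0.
Qed.

Lemma Ck_expR k f : Ck k f -> Ck k (fun x => expR (f x)).
Proof.
elim: k f => [|k IH] f hf.
  split=> // x; apply: continuous_comp; [exact: Ck_continuous hf _|exact: continuous_expR].
apply: (@CkS _ _ (fun i x => expR (f x) * partial i f x)).
- move=> x; apply: continuous_comp; [exact: Ck_continuous hf _|exact: continuous_expR].
- move=> i x; apply: is_derive_comp; exact: Ck_is_derive hf _ _.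
- move=> i; apply: Ck_mul; [apply: IH; exact: CkW|exact: Ck_partial].
Qed.

Lemma is_derive_inv f x v d : 0 < f x -> is_derive x v f d ->
  is_derive x v (fun y => (f y)^-1) (- ((f x)^-1 * (f x)^-1) * d).
Proof.
move=> f0 [df Ef]; have fx := lt0r_neq0 f0; split; first exact: derivableV.
by rewrite (deriveV fx df) Ef expr2 invfM.
Qed.

Lemma Ck_inv k f : (forall x, 0 < f x) -> Ck k f -> Ck k (fun x => (f x)^-1).
Proof.
move=> f0; elim: k => [|k IH] hf.
  split=> // x; apply: continuousV; [exact: lt0r_neq0|exact: Ck_continuous hf _].
apply: (@CkS _ _ (fun i x => - ((f x)^-1 * (f x)^-1) * partial i f x)).
- move=> x; apply: continuousV; [exact: lt0r_neq0|exact: Ck_continuous hf _].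
- by move=> i x; apply: is_derive_inv => //; exact: Ck_is_derive hf _ _.
- move=> i; apply: Ck_mul; last exact: Ck_partial.
  by apply: Ck_opp; apply: Ck_mul; apply: IH; exact: CkW.
Qed.

Lemma is_derive_lnf f x v d : 0 < f x -> is_derive x v f d ->
  is_derive x v (fun y => ln (f y)) ((f x)^-1 * d).
Proof. by move=> f0 df; apply: is_derive_comp; exact: is_derive1_ln. Qed.

Lemma Ck_ln k f : (forall x, 0 < f x) -> Ck k f -> Ck k (fun x => ln (f x)).
Proof.
have ct : (forall x, 0 < f x) -> continuous f -> continuous (fun x => ln (f x)).
  by move=> f0 cf x; apply: continuous_comp; [exact: cf|exact: continuous_ln].
move=> f0; case: k => [[cf _]|k hf]; first by split=> //; exact: ct.
apply: (@CkS _ _ (fun i x => (f x)^-1 * partial i f x)).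
- by apply: ct => //; exact: Ck_continuous hf.
- by move=> i x; apply: is_derive_lnf => //; exact: Ck_is_derive hf _ _.
- move=> i; apply: Ck_mul; last exact: Ck_partial.
  by apply: Ck_inv => //; exact: CkW.
Qed.

Lemma Ck_cos_sin k f : Ck k f ->
  Ck k (fun x => cos (f x)) /\ Ck k (fun x => sin (f x)).
Proof.
have cc (h : 'rV[R]_n -> R) : continuous h -> continuous (fun x => cos (h x)).
  by move=> ch x; apply: continuous_comp; [exact: ch|exact: continuous_cos].
have cs (h : 'rV[R]_n -> R) : continuous h -> continuous (fun x => sin (h x)).
  by move=> ch x; apply: continuous_comp; [exact: ch|exact: continuous_sin].
elim: k => [|k IH] hf.
  by split; (split=> //); [apply: cc|apply: cs]; case: hf.
have [hc hs] := IH (CkW hf); split.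
- apply: (@CkS _ _ (fun i x => - sin (f x) * partial i f x)).
  + by apply: cc; exact: Ck_continuous hf.
  + by move=> i x; apply: is_derive_comp; exact: Ck_is_derive hf _ _.
  + by move=> i; apply: Ck_mul; [exact: Ck_opp|exact: Ck_partial].
- apply: (@CkS _ _ (fun i x => cos (f x) * partial i f x)).
  + by apply: cs; exact: Ck_continuous hf.
  + by move=> i x; apply: is_derive_comp; exact: Ck_is_derive hf _ _.
  + by move=> i; apply: Ck_mul; [exact: hc|exact: Ck_partial].
Qed.

Lemma is_derive_shiftf f x y v d : is_derive (x + y) v f d ->
  is_derive x v (fun z => f (z + y)) d.
Proof.
move=> /is_derive_line0 h; apply/is_derive_line0; move: h.
by under eq_fun do rewrite addrA.
Qed.

Lemma Ck_shift k f y : Ck k f -> Ck k (fun x => f (x + y)).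
Proof.
have ct (h : 'rV[R]_n -> R) : continuous h -> continuous (fun x => h (x + y)).
  move=> ch x; apply: continuous_comp; last exact: ch.
  by apply: continuousD; [exact: cvg_id|exact: cst_continuous].
elim: k f => [|k IH] f hf; first by split=> //; apply: ct; case: hf.
apply: (@CkS _ _ (fun i x => partial i f (x + y))).
- by apply: ct; exact: Ck_continuous hf.
- by move=> i x; apply: is_derive_shiftf; exact: Ck_is_derive hf _ _.
- by move=> i; apply: IH; exact: Ck_partial.
Qed.

Lemma partial_add i f g : Ck 1 f -> Ck 1 g ->
  partial i (fun x => f x + g x) = (fun x => partial i f x + partial i g x).
Proof.
move=> hf hg; apply/funext => x; apply: partial_eq.
by apply: is_deriveD; [exact: Ck_is_derive hf _ _|exact: Ck_is_derive hg _ _].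
Qed.

Lemma partial_mul i f g : Ck 1 f -> Ck 1 g ->
  partial i (fun x => f x * g x) = (fun x => f x * partial i g x + g x * partial i f x).
Proof.
move=> hf hg; apply/funext => x; apply: partial_eq.
by apply: is_deriveM; [exact: Ck_is_derive hf _ _|exact: Ck_is_derive hg _ _].
Qed.

Lemma partial_cst i (c : R) : partial i (fun _ : 'rV[R]_n => c) = fun=> 0.
Proof. by apply/funext => x; apply: partial_eq; exact: is_derive_cst. Qed.

Lemma partial_scale i (c : R) f : Ck 1 f ->
  partial i (fun x => c * f x) = (fun x => c * partial i f x).
Proof.
move=> hf; rewrite (partial_mul i (Ck_cst 1 c) hf).
by apply/funext => x; rewrite partial_cst mulr0 addr0.
Qed.

Lemma partial_opp i f : Ck 1 f ->
  partial i (fun x => - f x) = (fun x => - partial i f x).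
Proof.
move=> hf; have := partial_scale i (-1) hf.
under eq_fun do rewrite mulN1r.
by move=> ->; apply/funext => x; rewrite mulN1r.
Qed.

Lemma partial_sub i f g : Ck 1 f -> Ck 1 g ->
  partial i (fun x => f x - g x) = (fun x => partial i f x - partial i g x).
Proof. by move=> hf hg; rewrite (partial_add i hf (Ck_opp hg)) (partial_opp i hg). Qed.

Lemma partial_comp i (F dF : R -> R) f : (forall x, is_derive (f x) 1 F (dF (f x))) ->
  Ck 1 f ->
  partial i (fun x => F (f x)) = (fun x => dF (f x) * partial i f x).
Proof.
move=> hF hf; apply/funext => x; apply: partial_eq.
by apply: is_derive_comp => //; exact: Ck_is_derive hf _ _.
Qed.

Lemma partial_expR i f : Ck 1 f ->
  partial i (fun x => expR (f x)) = (fun x => expR (f x) * partial i f x).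
Proof. by move=> h; apply: (@partial_comp _ (@expR R)). Qed.

Lemma partial_ln i f : (forall x, 0 < f x) -> Ck 1 f ->
  partial i (fun x => ln (f x)) = (fun x => (f x)^-1 * partial i f x).
Proof.
move=> f0 h.
exact: (@partial_comp i (@ln R) GRing.inv f (fun x => is_derive1_ln (f0 x)) h).
Qed.

Lemma partial_inv i f : (forall x, 0 < f x) -> Ck 1 f ->
  partial i (fun x => (f x)^-1) = (fun x => - ((f x)^-1 * (f x)^-1) * partial i f x).
Proof.
move=> f0 h; apply/funext => x; apply: partial_eq.
by apply: is_derive_inv => //; exact: Ck_is_derive h _ _.
Qed.

Lemma partial_cos i f : Ck 1 f ->
  partial i (fun x => cos (f x)) = (fun x => - sin (f x) * partial i f x).
Proof. by move=> h; apply: (@partial_comp _ (@cos R) (fun t => - sin t)). Qed.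

Lemma partial_sin i f : Ck 1 f ->
  partial i (fun x => sin (f x)) = (fun x => cos (f x) * partial i f x).
Proof. by move=> h; apply: (@partial_comp _ (@sin R) (@cos R)). Qed.

Lemma partial_shift i f y : Ck 1 f ->
  partial i (fun x => f (x + y)) = (fun x => partial i f (x + y)).
Proof.
move=> h; apply/funext => x; apply: partial_eq.
by apply: is_derive_shiftf; exact: Ck_is_derive h _ _.
Qed.

Lemma laplacianE f x : laplacian f x = \sum_i partial i (partial i f) x.
Proof. by apply: eq_bigr => i _; rewrite mxE. Qed.

End CkTheory.

(** * Second derivative test and periodic functions *)

Section SecondDerivativeTest.
Context {R : realType}.

(** If [d > 0], then [g1], which vanishes at [t0], is positive just to the right of [t0], and the
    mean value theorem produces a larger value of [g] there. *)
Lemma second_derivative_max (g g1 : R -> R) (t0 d : R) :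
  (forall t : R, is_derive t 1 g (g1 t)) -> is_derive t0 1 g1 d ->
  (\forall t \near t0, g t <= g t0) -> g1 t0 = 0 /\ d <= 0.
Proof.
move=> dg dg1 /nbhs_normP[e /= e0 emax].
have maxE t : `|t - t0| < e -> g t <= g t0 by move=> h; apply: emax; rewrite /= distrC.
have g10 : g1 t0 = 0.
  suff : is_derive t0 1 g 0 by move=> [_ <-]; have [] := dg t0.
  apply: (@derive1_at_max _ g (t0 - e) (t0 + e)).
  - lra.
  - by move=> t _; have [] := dg t.
  - by rewrite in_itv /=; lra.
  - move=> t; rewrite in_itv /= => /andP[h1 h2]; apply: maxE.
    by rewrite ltr_norml; lra.
split=> //; rewrite leNgt; apply/negP => d0.
have [dr dE] := dg1.
have : \forall h \near (0 : R)^', 0 < h^-1 * (g1 (h + t0) - g1 t0).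
  have : h^-1 *: ((g1 \o shift t0) (h *: 1) - g1 t0) @[h --> (0 : R)^'] --> d.
    by rewrite -dE; exact: dr.
  move=> /(cvgr_gt d) /(_ _ d0); apply: filterS => h /=.
  by rewrite [_%:A]mulr1.
move=> /nbhs_normP[r /= r0 rP].
pose h := Num.min e r / 2.
have h0 : 0 < h by rewrite /h divr_gt0 // lt_min e0 r0.
have me : Num.min e r <= e by rewrite ge_min lexx.
have mr : Num.min e r <= r by rewrite ge_min lexx orbT.
have he : h < e by rewrite /h; lra.
have hr : h < r by rewrite /h; lra.
have [||c] := @MVT _ g g1 t0 (t0 + h).
- by lra.
- by apply: derivable_within_continuous => x _; have [] := dg x.
rewrite in_itv /= => /andP[c1 c2] E.
have c10 : 0 < g1 c.
  have := rP (c - t0); rewrite /= sub0r normrN gtr0_norm ?subr_gt0 //.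
  have ct : 0 < c - t0 by lra.
  move=> /(_ _ (lt0r_neq0 ct)); rewrite subrK g10 subr0 pmulr_rgt0 ?invr_gt0 //.
  by apply; lra.
have hE : t0 + h - t0 = h by ring.
have := maxE (t0 + h); rewrite hE gtr0_norm // => /(_ he).
have : 0 < g1 c * h by rewrite mulr_gt0.
by move: E; rewrite hE; lra.
Qed.

Context {n : nat}.
Implicit Types (f : 'rV[R]_n -> R) (x : 'rV[R]_n).

Lemma near_line x (v : 'rV[R]_n) (A : 'rV[R]_n -> Prop) :
  (\forall y \near x, A y) -> \forall h \near (0 : R), A (h *: v + x).
Proof.
have h : {for (0 : R), continuous (fun h : R => h *: v + x)}.
  apply: continuousD; last exact: cst_continuous.
  exact: scalel_continuous.
by move=> Ax; have := h A; rewrite scale0r add0r; apply.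
Qed.

Lemma local_max_test f x (i : 'I_n) : Ck 2 f ->
  (\forall y \near x, f y <= f x) ->
  partial i f x = 0 /\ partial i (partial i f) x <= 0.
Proof.
move=> hf fx; pose e : 'rV[R]_n := delta_mx 0 i.
have := @second_derivative_max (fun h => f (h *: e + x))
  (fun h => partial i f (h *: e + x)) 0 (partial i (partial i f) x).
rewrite scale0r add0r; apply.
- by move=> t; apply/is_derive_line; exact: Ck_is_derive hf _ _.
- by apply/is_derive_line0; exact: Ck_is_derive (Ck_partial hf i) _ _.
- exact: (@near_line x e (fun y => f y <= f x)).
Qed.

Lemma local_min_test f x (i : 'I_n) : Ck 2 f ->
  (\forall y \near x, f x <= f y) ->
  partial i f x = 0 /\ 0 <= partial i (partial i f) x.
Proof.
move=> hf fx; have := @local_max_test (fun y => - f y) x i (Ck_opp hf).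
rewrite partial_opp; last exact: CkW.
rewrite partial_opp; last exact: Ck_partial.
case; first by near=> y; rewrite lerN2; near: y.
by move=> /eqP; rewrite oppr_eq0 => /eqP -> ; rewrite oppr_le0.
Unshelve. all: by end_near. Qed.

Lemma continuous_dist f : continuous f <->
  forall x (e : R), 0 < e -> \forall y \near x, `|f x - f y| < e.
Proof.
split=> cf x.
  have : f y @[y --> x] --> f x by exact: cf.
  by move/cvgrPdist_lt.
suff : f y @[y --> x] --> f x by [].
apply/(@cvgrPdist_lt _ _ _ _ (nbhs_filter x)) => e; exact: cf.
Qed.

End SecondDerivativeTest.

(** * Compactness arguments for periodic functions *)

Section Periodic.
Context {R : realType} {n : nat}.
Implicit Types (f g : 'rV[R]_n -> R) (x y : 'rV[R]_n).

Definition unit_cube : set 'rV[R]_n := [set x | forall i, 0 <= x 0 i <= 1].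

Lemma compact_unit_cube : compact unit_cube.
Proof.
have h := @rV_compact R n (fun=> `[(0 : R), 1]%classic) (fun=> @segment_compact R 0 1).
rewrite (_ : unit_cube =
  [set v : 'rV[R]_n | forall i : 'I_n, `[(0 : R), 1]%classic (v ord0 i)]) //.
Qed.

Lemma unit_cube0 : unit_cube !=set0.
Proof. by exists 0 => i; rewrite mxE lexx ler01. Qed.

Lemma unit_cube_shift x : exists m : 'rV[int]_n, unit_cube (x + map_mx intr m).
Proof.
exists (\row_i - Num.floor (x 0 i)) => i; rewrite !mxE.
have := floor_itv (x 0 i); rewrite rmorphD rmorph1 rmorphN /=; lra.
Qed.

Lemma Zperiodic_max f : continuous f -> Zperiodic f ->
  exists x0, forall x, f x <= f x0.
Proof.
move=> cf pf.
have [|x0 _ h] := @EVT_max_rV _ _ f unit_cube unit_cube0 compact_unit_cube.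
  exact: continuous_subspaceT.
exists x0 => x; have [m xm] := unit_cube_shift x.
by rewrite -(pf m x); apply: h; rewrite inE.
Qed.

Lemma ZperiodicN f : Zperiodic f -> Zperiodic (fun x => - f x).
Proof. by move=> pf m x; rewrite pf. Qed.

Lemma Zperiodic_min f : continuous f -> Zperiodic f ->
  exists x0, forall x, f x0 <= f x.
Proof.
move=> cf /ZperiodicN pf; have [|x0 h] := Zperiodic_max _ pf.
  by move=> x; apply: continuousN; exact: cf.
by exists x0 => x; rewrite -lerN2.
Qed.

Lemma Zperiodic_bounded f : continuous f -> Zperiodic f ->
  exists2 M, 0 < M & forall x, `|f x| <= M.
Proof.
move=> cf pf; have [x0 h0] := Zperiodic_max cf pf.
have [x1 h1] := Zperiodic_min cf pf.
exists (`|f x0| + `|f x1| + 1) => [|x].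
  by rewrite ltr_wpDl // addr_ge0.
rewrite ler_norml.
have := h0 x; have := h1 x; have := ler_norm (f x0); have := ler_norm (- f x1).
have := normr_ge0 (f x0); have := normr_ge0 (f x1).
rewrite normrN; lra.
Qed.

(** Compactness of the unit cube makes the neighbourhood of [h = 0] independent of [x] in the cube;
    an integer translation brings every other [x] there. *)
Lemma Zperiodic_unif_continuous f (e : R) : continuous f -> Zperiodic f -> 0 < e ->
  \forall h \near (0 : 'rV[R]_n), forall x, `|f (x + h) - f x| < e.
Proof.
move=> cf pf e0.
have : \forall h \near (0 : 'rV[R]_n), unit_cube `<=` (fun x => `|f (x + h) - f x| < e).
  have /compact_near_coveringP ncov := compact_unit_cube.
  have := ncov _ (nbhs (0 : 'rV[R]_n)) (fun h x => `|f (x + h) - f x| < e).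
  apply=> x _.
  have cfx := cf x.
  have c2 : (fun p : 'rV[R]_n * 'rV[R]_n => f (p.1 + p.2)) @ (x, 0 : 'rV[R]_n) --> f x.
    apply: (@cvg_comp _ _ _ (fun p : 'rV[R]_n * 'rV[R]_n => p.1 + p.2) f _ (nbhs x)); last exact: cf.
    have : (fun p : 'rV[R]_n * 'rV[R]_n => p.1 + p.2) @ (x, 0 : 'rV[R]_n) --> x + 0.
      by apply: cvgD; [exact: cvg_fst|exact: cvg_snd].
    by rewrite addr0.
  have c1 : (fun p : 'rV[R]_n * 'rV[R]_n => f p.1) @ (x, 0 : 'rV[R]_n) --> f x.
    by apply: (@cvg_comp _ _ _ fst f _ (nbhs x)); [exact: cvg_fst|exact: cf].
  have e2 : 0 < e / 2 by lra.
  move/cvgrPdist_lt : c1 => /(_ _ e2); move/cvgrPdist_lt : c2 => /(_ _ e2).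
  apply: filterS2 => -[y h] /= h2 h1.
  rewrite (_ : f (y + h) - f y = (f x - f y) - (f x - f (y + h))); last by ring.
  by rewrite (le_lt_trans (ler_normB _ _)) // [e]splitr ltrD.
apply: filterS => h hC x.
have [m xm] := unit_cube_shift x.
have := hC _ xm; by rewrite addrAC !pf.
Qed.

End Periodic.

(** * The constant coefficient operator *)

Section MaxPrinciple.
Context {R : realType} {n : nat}.
Implicit Types (f g w : 'rV[R]_n -> R) (x y : 'rV[R]_n).

Lemma local_max_grad_laplacian f x : Ck 2 f -> (\forall y \near x, f y <= f x) ->
  grad f x = 0 /\ laplacian f x <= 0.
Proof.
move=> hf fx; split.
  by apply/rowP => i; rewrite !mxE; have [] := local_max_test i hf fx.
by rewrite laplacianE; apply: sumr_le0 => i _; have [] := local_max_test i hf fx.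
Qed.

Lemma local_min_grad_laplacian f x : Ck 2 f -> (\forall y \near x, f x <= f y) ->
  grad f x = 0 /\ 0 <= laplacian f x.
Proof.
move=> hf fx; split.
  by apply/rowP => i; rewrite !mxE; have [] := local_min_test i hf fx.
by rewrite laplacianE; apply: sumr_ge0 => i _; have [] := local_min_test i hf fx.
Qed.

Lemma laplacianD f g x : Ck 2 f -> Ck 2 g ->
  laplacian (fun y => f y + g y) x = laplacian f x + laplacian g x.
Proof.
move=> hf hg; rewrite !laplacianE -big_split; apply: eq_bigr => i _ /=.
by rewrite (partial_add _ (CkW hf) (CkW hg)) (partial_add _ (Ck_partial hf i) (Ck_partial hg i)).
Qed.

Lemma laplacianZ (c : R) f x : Ck 2 f ->
  laplacian (fun y => c * f y) x = c * laplacian f x.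
Proof.
move=> hf; rewrite !laplacianE mulr_sumr; apply: eq_bigr => i _ /=.
by rewrite (partial_scale _ _ (CkW hf)) (partial_scale _ _ (Ck_partial hf i)).
Qed.

Lemma gradD f g x : Ck 1 f -> Ck 1 g ->
  grad (fun y => f y + g y) x = grad f x + grad g x.
Proof. by move=> hf hg; apply/rowP => i; rewrite !mxE partial_add. Qed.

Lemma gradZ (c : R) f x : Ck 1 f -> grad (fun y => c * f y) x = c *: grad f x.
Proof. by move=> hf; apply/rowP => i; rewrite !mxE partial_scale. Qed.

Lemma laplacianB f g x : Ck 2 f -> Ck 2 g ->
  laplacian (fun y => f y - g y) x = laplacian f x - laplacian g x.
Proof.
move=> hf hg; rewrite (laplacianD _ hf (Ck_opp hg)); congr (_ + _).
by rewrite -mulN1r -(laplacianZ _ _ hg); under [in RHS]eq_fun do rewrite mulN1r.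
Qed.

Lemma gradB f g x : Ck 1 f -> Ck 1 g ->
  grad (fun y => f y - g y) x = grad f x - grad g x.
Proof. by move=> hf hg; apply/rowP => i; rewrite !mxE (partial_sub _ hf hg). Qed.

Lemma dotDr (p q r : 'rV[R]_n) : dot p (q + r) = dot p q + dot p r.
Proof. by rewrite /dot -big_split; apply: eq_bigr => i _; rewrite mxE mulrDr. Qed.

Lemma dotZr (c : R) (p q : 'rV[R]_n) : dot p (c *: q) = c * dot p q.
Proof. by rewrite /dot mulr_sumr; apply: eq_bigr => i _; rewrite mxE mulrCA. Qed.

Lemma dot0r (p : 'rV[R]_n) : dot p 0 = 0.
Proof. by rewrite /dot big1 // => i _; rewrite mxE mulr0. Qed.

Lemma dotC (p q : 'rV[R]_n) : dot p q = dot q p.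
Proof. by apply: eq_bigr => i _; rewrite mulrC. Qed.

Lemma dotDl (p q r : 'rV[R]_n) : dot (p + q) r = dot p r + dot q r.
Proof. by rewrite ![dot _ r]dotC dotDr. Qed.

Lemma dotZl (c : R) (p q : 'rV[R]_n) : dot (c *: p) q = c * dot p q.
Proof. by rewrite ![dot _ q]dotC dotZr. Qed.

Variables (a k : R) (b : 'rV[R]_n).
Hypotheses (a0 : 0 < a) (k0 : 0 < k).

(** The operator A of the overview, used with [a = sigma ^+ 4 / 2] and [b = sigma ^+ 2 *: P]. *)
Definition elliptic w x : R := k * w x - a * laplacian w x + dot b (grad w x).

Lemma ellipticD f g x : Ck 2 f -> Ck 2 g -> elliptic (fun y => f y + g y) x = elliptic f x + elliptic g x.
Proof.
move=> hf hg; rewrite /elliptic (laplacianD _ hf hg) (gradD _ (CkW hf) (CkW hg)) dotDr.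
move: (laplacian f x) (laplacian g x) (dot _ _) (dot _ _) (f x) (g x) => *; ring.
Qed.

Lemma ellipticZ (c : R) f x : Ck 2 f -> elliptic (fun y => c * f y) x = c * elliptic f x.
Proof.
move=> hf; rewrite /elliptic (laplacianZ _ _ hf) (gradZ _ _ (CkW hf)) dotZr.
move: (laplacian f x) (dot _ _) (f x) => *; ring.
Qed.

Lemma ellipticN f x : Ck 2 f -> elliptic (fun y => - f y) x = - elliptic f x.
Proof.
move=> /(ellipticZ (-1) x); rewrite mulN1r => <-.
by congr elliptic; apply/funext => y; rewrite mulN1r.
Qed.

Lemma ellipticB f g x : Ck 2 f -> Ck 2 g -> elliptic (fun y => f y - g y) x = elliptic f x - elliptic g x.
Proof. by move=> hf hg; rewrite (ellipticD _ hf (Ck_opp hg)) (ellipticN _ hg). Qed.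

Lemma elliptic_shift f x y : Ck 2 f -> elliptic (fun z => f (z + y)) x = elliptic f (x + y).
Proof.
move=> hf.
have E1 : laplacian (fun z => f (z + y)) x = laplacian f (x + y).
  rewrite !laplacianE; apply: eq_bigr => i _.
  by rewrite (partial_shift _ _ (CkW hf)) (partial_shift _ _ (Ck_partial hf i)).
have E2 : grad (fun z => f (z + y)) x = grad f (x + y).
  by apply/rowP => i; rewrite !mxE (partial_shift _ _ (CkW hf)).
by rewrite /elliptic E1 E2.
Qed.

(** At a maximum point [x0] of [w] the gradient vanishes and the Laplacian is nonpositive, whence
    [k * w x0 <= elliptic w x0]. *)
Lemma elliptic_upper_bound w (M : R) : Ck 2 w -> Zperiodic w ->
  (forall x, elliptic w x <= M) -> forall x, k * w x <= M.
Proof.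
move=> hw pw wM x; have [x0 h0] := Zperiodic_max (Ck_continuous hw) pw.
have [|g0 l0] := @local_max_grad_laplacian w x0 hw; first by near=> y; exact: h0.
have := wM x0; rewrite /elliptic g0 dot0r addr0.
have : k * w x <= k * w x0 by rewrite ler_pM2l.
have : a * laplacian w x0 <= 0 by rewrite pmulr_rle0.
by move: (a * _) => *; lra.
Unshelve. all: by end_near.
Qed.

Lemma elliptic_lower_bound w (M : R) : Ck 2 w -> Zperiodic w ->
  (forall x, M <= elliptic w x) -> forall x, M <= k * w x.
Proof.
move=> hw pw wM x.
have := @elliptic_upper_bound (fun y => - w y) (- M) (Ck_opp hw) (ZperiodicN pw).
by rewrite -lerN2 -mulrN; apply=> y; rewrite ellipticN// lerN2.
Qed.

(* Doubling of variables: at an interior maximum of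
   w (x + s e_i) - w (x - s e_i) - (L s - N s ^ 2) over (x, s) the gradients of w at
   both points agree and the difference of the Laplacians is at most - 2 N. *)
Lemma elliptic_centered_difference w (M : R) (i : 'I_n) : Ck 2 w -> Zperiodic w -> 0 < M ->
  (forall x, `|elliptic w x| <= M) -> forall x (s : R), 0 <= s <= 1 ->
  w (s *: delta_mx 0 i + x) - w ((- s) *: delta_mx 0 i + x)
    <= (2 * M / k + 2 * M / a) * s - 2 * M / a * s ^+ 2.
Proof.
move=> hw pw M0 wM; pose e : 'rV[R]_n := delta_mx 0 i.
(* The final contradiction: subtracting the bounds on [elliptic w] at two points with equal
   gradients gives a difference of at most [2 * F], whereas the last two hypotheses force more than
   [4 * F]. *)
have arith (A B C D E F : R) : 0 < F -> - F <= E - B + C <= F ->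
    - F <= D - A + C <= F -> 0 < D - E -> A - B <= - (4 * F) -> False.
  by move=> *; lra.
(* [N] is such that [a * (2 * N) = 4 * M] exceeds the possible variation [2 * M] of [elliptic w];
   [L] is such that [om 1 = 2 * M / k], a bound for all increments of [w]. *)
pose N := 2 * M / a; pose L := 2 * M / k + N.
pose om (s : R) := L * s - N * s ^+ 2.
pose Phi (p : 'rV[R]_n * R) := w (p.2 *: e + p.1) - w ((- p.2) *: e + p.1) - om p.2.
have N0 : 0 < N by rewrite /N divr_gt0 // mulr_gt0.
have L0 : N < L by rewrite /L ltrDr divr_gt0 // mulr_gt0.
have cw := Ck_continuous hw.
have cPhi : continuous Phi.
  move=> p.
  have c1 : (fun p : 'rV[R]_n * R => p.1) @ p --> p.1 by exact: cvg_fst.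
  have c2 : (fun p : 'rV[R]_n * R => p.2) @ p --> p.2 by exact: cvg_snd.
  apply: cvgB; first apply: cvgB.
  - apply: (@cvg_comp _ _ _ (fun p : 'rV[R]_n * R => p.2 *: e + p.1) w _ (nbhs (p.2 *: e + p.1))); last exact: cw.
    by apply: cvgD => //; apply: cvgZ => //; exact: cvg_cst.
  - apply: (@cvg_comp _ _ _ (fun p : 'rV[R]_n * R => (- p.2) *: e + p.1) w _ (nbhs ((- p.2) *: e + p.1))); last exact: cw.
    by apply: cvgD => //; apply: cvgZ; [exact: cvgN|exact: cvg_cst].
  - apply: cvgB; first by apply: cvgM => //; exact: cvg_cst.
    by apply: cvgM; [exact: cvg_cst|exact: cvgM].
have cpt : compact (@unit_cube R n `*` `[(0 : R), 1]%classic).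
  by apply: compact_setX; [exact: compact_unit_cube|exact: segment_compact].
have ne : (@unit_cube R n `*` `[(0 : R), 1]%classic) !=set0.
  by have [z hz] := @unit_cube0 R n; exists (z, 0); split => //=; rewrite in_itv /= lexx ler01.
have [|[x0 s0] /set_mem[_ /= s01] PhiM] := compact_EVT_max ne cpt (f := Phi).
  exact: continuous_subspaceT.
have {}PhiM x s : 0 <= s <= 1 -> Phi (x, s) <= Phi (x0, s0).
  move=> hs; have [m xm] := unit_cube_shift x.
  rewrite -[Phi (x, s)](_ : Phi (x + map_mx intr m, s) = _); last first.
    by rewrite /Phi /= !addrA !pw.
  by apply: PhiM; rewrite inE; split => //=; rewrite in_itv.
suff Phi0 : Phi (x0, s0) <= 0.
  move=> x s hs; rewrite -subr_le0; exact: le_trans (PhiM x s hs) Phi0.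
rewrite leNgt; apply/negP => Phi0.
have wk x : `|w x| <= M / k.
  rewrite ler_norml -mulNr ler_pdivrMr // ler_pdivlMr // ![w x * k]mulrC.
  apply/andP; split.
    by apply: elliptic_lower_bound => // y; have := wM y; rewrite ler_norml => /andP[].
  by apply: elliptic_upper_bound => // y; have := wM y; rewrite ler_norml => /andP[].
(* [Phi] vanishes at [s = 0], and [|w| <= M / k] makes it nonpositive at [s = 1]; a positive maximum
   is therefore interior in [s]. *)
have {}s01 : 0 < s0 < 1.
  move: s01; rewrite in_itv /= => /andP[s00 s01]; rewrite !lt_neqAle s00 s01 !andbT.
  apply/andP; split; apply/negP => /eqP s0E; move: Phi0.
    by rewrite /Phi -s0E /= oppr0 !scale0r /om mulr0 expr0n mulr0 !subrr ltxx.
  rewrite /Phi s0E /= /om expr1n !mulr1 /L.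
  have := wk (1 *: e + x0); have := wk ((-1) *: e + x0).
  rewrite !ler_norml -!mulrA; lra.
pose p := s0 *: e + x0; pose q := (- s0) *: e + x0.
have hshift (s : R) : Ck 2 (fun y => w (s *: e + y)).
  by rewrite (_ : (fun _ => _) = fun y => w (y + s *: e)); [exact: Ck_shift|apply/funext => y; rewrite addrC].
have pshift (s : R) (j : 'I_n) f : Ck 1 f -> partial j (fun y => f (s *: e + y)) = fun y => partial j f (s *: e + y).
  move=> hf; rewrite (_ : (fun y => f _) = fun y => f (y + s *: e)).
    by rewrite partial_shift //; apply/funext => y; rewrite addrC.
  by apply/funext => y; rewrite addrC.
have xtest (j : 'I_n) : partial j w p = partial j w q /\
    partial j (partial j w) p <= partial j (partial j w) q.
  have := @local_max_test _ _ (fun y => w (s0 *: e + y) - w ((- s0) *: e + y)) x0 j.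
  case; [exact: (Ck_sub (hshift _) (hshift _))| |].
    apply: filterE => y; have [h1 h2] := andP s01.
    by have := PhiM y s0; rewrite (ltW h1) (ltW h2) => /(_ isT); rewrite /Phi lerD2r.
  rewrite (partial_sub _ (CkW (hshift _)) (CkW (hshift _))).
  rewrite (partial_sub _ (Ck_partial (hshift _) j) (Ck_partial (hshift _) j)).
  rewrite (pshift s0 j _ (CkW hw)) (pshift (- s0) j _ (CkW hw)).
  rewrite (pshift s0 j _ (Ck_partial hw j)) (pshift (- s0) j _ (Ck_partial hw j)).
  by move=> /eqP; rewrite subr_eq0 => /eqP -> ; rewrite subr_le0.
(* The second-order condition in [s]. The reflection [s -> - s] turns the second derivative into a
   difference between [p] and [q], and the quadratic part of [om] contributes the gain [2 * N]. *)
have stest : partial i (partial i w) p - partial i (partial i w) q <= - (2 * N).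
  have dline (f : 'rV[R]_n -> R) (t : R) : Ck 1 f ->
      is_derive t 1 (fun s : R => f (s *: e + x0)) (partial i f (t *: e + x0)) /\
      is_derive t 1 (fun s : R => f ((- s) *: e + x0)) (- partial i f ((- t) *: e + x0)).
    move=> hf.
    have h1 (r : R) : is_derive r 1 (fun s : R => f (s *: e + x0)) (partial i f (r *: e + x0)).
      by apply/is_derive_line; exact: Ck_is_derive hf _ _.
    split=> //.
    have := @is_derive_comp R R (fun s : R => f (s *: e + x0)) -%R t 1 _ _ (h1 (- t)) (is_deriveNid t 1).
    by rewrite mulrN1.
  have := @second_derivative_max _ (fun s => Phi (x0, s))
    (fun s => partial i w (s *: e + x0) + partial i w ((- s) *: e + x0) - (L - 2 * N * s)) s0
    (partial i (partial i w) p - partial i (partial i w) q + 2 * N).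
  case.
  - move=> t; have [d1 d2] := dline w t (CkW hw).
    have d3 : is_derive t 1 om (L - 2 * N * t).
      rewrite /om; apply: is_derive_eq.
      rewrite /GRing.scale /=; ring.
    have := @is_deriveB _ _ _ _ _ _ _ _ _ (@is_deriveB _ _ _ _ _ _ _ _ _ d1 d2) d3.
    by rewrite opprK.
  - have [d1 d2] := dline (partial i w) s0 (Ck_partial hw i).
    have d3 : is_derive s0 1 (fun s => L - 2 * N * s) (- 2 * N).
      apply: is_derive_eq.
      rewrite /GRing.scale /=; ring.
    have := @is_deriveB _ _ _ _ _ _ _ _ _ (@is_deriveD _ _ _ _ _ _ _ _ _ d1 d2) d3.
    by rewrite mulNr opprK.
  - have : s0 \in `]0, 1[ by rewrite in_itv.
    move/near_in_itvoo; apply: filterS => s; rewrite in_itv /= => /andP[h1 h2].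
    by apply: PhiM; rewrite !ltW.
  - move=> _; move: (partial i (partial i w) p) (partial i (partial i w) q) => A B; lra.
have gE : grad w p = grad w q by apply/rowP => j; rewrite !mxE (xtest j).1.
have lapE : laplacian w p - laplacian w q <= - (2 * N).
  rewrite !laplacianE -sumrB (bigD1 i) //= -[leRHS]addr0; apply: lerD => //.
  by apply: sumr_le0 => j _; rewrite subr_le0 (xtest j).2.
have om0 : 0 <= om s0.
  have [h1 h2] := andP s01; rewrite /om expr2 mulrA -mulrBl mulr_ge0 ?ltW //.
  by rewrite subr_gt0 (le_lt_trans _ L0) // ger_pMr // ltW.
have wpq : 0 < w p - w q.
  move: Phi0 om0; rewrite /Phi /= -/p -/q.
  by rewrite subr_gt0 => h1 h2; exact: le_lt_trans h2 h1.
have : a * (laplacian w p - laplacian w q) <= - (4 * M).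
  rewrite (_ : - (4 * M) = a * - (2 * N)) ?ler_pM2l //.
  by rewrite /N mulrN mulrCA mulrA; congr (- _); field; exact: lt0r_neq0.
have : 0 < k * (w p - w q) by rewrite mulr_gt0.
rewrite (mulrBr k (w p) (w q)).
rewrite (mulrBr a (laplacian w p) (laplacian w q)) => h2 h1.
have h3 := wM p.
have h4 := wM q.
rewrite ler_norml in h3.
rewrite ler_norml in h4.
rewrite /elliptic gE in h3.
rewrite /elliptic in h4.
exact: (arith _ _ _ _ _ _ M0 h4 h3 h2 h1).
Qed.

End MaxPrinciple.

(** * Regularity *)

Section Approximation.
Context {R : realType} {n : nat}.
Implicit Types (f g w : 'rV[R]_n -> R) (x y : 'rV[R]_n).
Variables (a k : R) (b : 'rV[R]_n).
Hypotheses (a0 : 0 < a) (k0 : 0 < k).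
Local Notation elliptic := (elliptic a k b).

(** The centred estimate is used at the midpoint with step [s / 2], its quadratic term being
    dropped. Applying it to [w] and [- w] gives the absolute value; for [h < 0] the two endpoints
    are exchanged. *)
Lemma elliptic_lipschitz w (M : R) (i : 'I_n) x (h : R) : Ck 2 w -> Zperiodic w -> 0 < M ->
  (forall x, `|elliptic w x| <= M) -> `|h| <= 1 ->
  `|w (h *: 'e_i + x) - w x| <= (k^-1 + a^-1) * M * `|h|.
Proof.
move=> hw pw M0 wM.
have key v (s : R) y : Ck 2 v -> Zperiodic v -> (forall x, `|elliptic v x| <= M) ->
    0 <= s <= 1 -> v (s *: 'e_i + y) - v y <= (k^-1 + a^-1) * M * s.
  move=> hv pv vM /andP[s0 s1].
  have := @elliptic_centered_difference _ _ a k b a0 k0 v M i hv pv M0 vM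
    ((s / 2) *: 'e_i + y) (s / 2).
  have e2 : (s / 2) *: 'e_i + (s / 2) *: 'e_i = s *: 'e_i :> 'rV[R]_n.
    by rewrite -scalerDl -splitr.
  have e3 : (- (s / 2)) *: 'e_i + (s / 2) *: 'e_i = 0 :> 'rV[R]_n.
    by rewrite -scalerDl addNr scale0r.
  rewrite !addrA e2 e3 add0r => /(_ _)/le_trans; apply.
    by apply/andP; split; lra.
  have M2 : 0 <= 2 * M / a * (s / 2) ^+ 2.
    by rewrite mulr_ge0 ?sqr_ge0 // divr_ge0 ?mulr_ge0 // ltW.
  rewrite (_ : (k^-1 + a^-1) * M * s = (2 * M / k + 2 * M / a) * (s / 2)); first lra.
  by field; rewrite !lt0r_neq0.
have hN : forall x, `|elliptic (fun y => - w y) x| <= M.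
  by move=> y; rewrite ellipticN // normrN.
have both (s : R) y : 0 <= s <= 1 ->
    `|w (s *: 'e_i + y) - w y| <= (k^-1 + a^-1) * M * s.
  move=> s01; have h1 := key w s y hw pw wM s01.
  have h2 := key (fun y => - w y) s y (Ck_opp hw) (ZperiodicN pw) hN s01.
  by rewrite ler_norml; apply/andP; split; lra.
rewrite ler_norml => /andP[h1 h2].
have [h0|h0] := leP 0 h; first by rewrite (ger0_norm h0); apply: both; rewrite h0.
rewrite (ltr0_norm h0) distrC.
have := both (- h) (h *: 'e_i + x); rewrite addrA -scalerDl addNr scale0r add0r.
by apply; apply/andP; split; lra.
Qed.

(* A weak form of [elliptic w = g]: uniform limits of classical solutions.  It is stable under
   translation, linear combination and uniform limits, and implies C^1 regularity. *)
Definition approx_sol w g := forall e : R, 0 < e -> exists v, [/\ Ck 2 v, Zperiodic v,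
  forall x, `|w x - v x| <= e & forall x, `|g x - elliptic v x| <= e].

Let C := k^-1 + a^-1.
Let C0 : 0 < C. Proof. by rewrite addr_gt0 // invr_gt0. Qed.

(** For a finer approximation [v'], the Lipschitz bound applies to [v' - v], whose image under
    [elliptic] is at most [e + d]. Letting [d] tend to 0 shows that [w - v] has Lipschitz constant
    [C * e] along the axes, before any derivative of [w] is known to exist. *)
Lemma approx_sol_quotient w g (e : R) v : approx_sol w g ->
  Ck 2 v -> Zperiodic v -> 0 < e -> (forall x, `|g x - elliptic v x| <= e) ->
  forall (i : 'I_n) x (h : R), `|h| <= 1 ->
  `|(w (h *: 'e_i + x) - w x) - (v (h *: 'e_i + x) - v x)| <= C * e * `|h|.
Proof.
move=> wg hv pv e0 gv i x h h1; apply/ler_addgt0Pr => r r0.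
(* Replacing [w] by [v'] at two points costs [2 * d], and the Lipschitz constant costs [C * d * |h|]
   more; together exactly [r]. *)
pose d := r / (C * `|h| + 2).
have D0 : 0 < C * `|h| + 2 by rewrite ltr_wpDl // mulr_ge0 // ltW.
have d0 : 0 < d by rewrite divr_gt0.
have [v' [hv' pv' wv' gv']] := wg _ d0.
have vv' z : `|elliptic (fun y => v' y - v y) z| <= e + d.
  rewrite ellipticB //.
  rewrite (_ : _ - _ = (g z - elliptic v z) - (g z - elliptic v' z)); last first.
    by move: (elliptic v z) (elliptic v' z) => *; ring.
  by rewrite (le_trans (ler_normB _ _)) // lerD.
have pvv : Zperiodic (fun y => v' y - v y) by move=> m y; rewrite pv' pv.
have := @elliptic_lipschitz (fun y => v' y - v y) (e + d) i x h (Ck_sub hv' hv) pvv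
  (addr_gt0 e0 d0) vv' h1.
rewrite -/C => L.
rewrite (_ : _ - _ = ((w (h *: 'e_i + x) - v' (h *: 'e_i + x)) - (w x - v' x)) +
  ((v' (h *: 'e_i + x) - v (h *: 'e_i + x)) - (v' x - v x))); last by ring.
rewrite (le_trans (ler_normD _ _)) // (le_trans (lerD (ler_normB _ _) L)) //.
rewrite (le_trans (lerD (lerD (wv' _) (wv' _)) (lexx _))) //.
suff <- : d * (C * `|h| + 2) = r by lra.
by rewrite /d divfK // lt0r_neq0.
Qed.

(** The difference quotients of [w] stay within [C * e] of those of a C^2 function, so they satisfy
    the Cauchy criterion; the partial derivatives obtained are uniform limits of continuous ones. *)
Lemma approx_sol_Ck1 w g : approx_sol w g -> Ck 1 w.
Proof.
move=> wg.
have cw : continuous w.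
  apply/continuous_dist => x e e0.
  have e3 : 0 < e / 3 by rewrite divr_gt0.
  have [v [hv _ wv _]] := wg _ e3.
  have /continuous_dist/(_ x _ e3) := Ck_continuous hv; apply: filterS => y vxy.
  rewrite (_ : w x - w y = (w x - v x) + (v x - v y) - (w y - v y)); last by ring.
  rewrite (le_lt_trans (ler_normB _ _)) //.
  rewrite (le_lt_trans (lerD (ler_normD _ _) (lexx _))) //.
  by have := wv x; have := wv y; lra.
pose Q i x (h : R) := h^-1 *: ((w \o shift x) (h *: 'e_i) - w x).
have QE v i x (e : R) : Ck 2 v -> Zperiodic v -> 0 < e -> (forall x, `|g x - elliptic v x| <= e) ->
    \forall h \near (0 : R)^', `|Q i x h - h^-1 *: ((v \o shift x) (h *: 'e_i) - v x)| <= C * e.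
  move=> hv pv e0 gv.
  near=> h.
  have h0 : h != 0 by near: h; exact: nbhs_dnbhs_neq.
  have h1 : `|h| <= 1.
    by near: h; exact: dnbhs0_le.
  rewrite /Q -scalerBr normrZ normfV ler_pdivrMl ?normr_gt0 // [leRHS]mulrC.
  exact: (approx_sol_quotient wg hv pv e0 gv i x h1).
have dw i x : derivable w x 'e_i.
  apply/cauchy_cvgP/cauchy_exP => e e0.
  have e1 : 0 < e / (2 * C) by rewrite divr_gt0 // mulr_gt0.
  have [v [hv pv _ gv]] := wg _ e1.
  exists (partial i v x).
  have dv : derivable v x 'e_i by exact: (Ck_derivable hv).
  have e2 : 0 < e / 2 by lra.
  have : h^-1 *: ((v \o shift x) (h *: 'e_i) - v x) @[h --> (0 : R)^'] --> partial i v x by exact: dv.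
  move=> /cvgrPdist_lt => /(_ _ e2).
  apply: filterS2 (QE v i x _ hv pv e1 gv) => h h1 h2.
  rewrite /ball /= -/(Q i x h).
  have -> : partial i v x - Q i x h = (partial i v x - h^-1 *: ((v \o shift x) (h *: 'e_i) - v x))
     - (Q i x h - h^-1 *: ((v \o shift x) (h *: 'e_i) - v x)).
    by move: (partial i v x) (Q i x h) => A B; ring.
  rewrite (le_lt_trans (ler_normB _ _)) // [e]splitr ltr_leD // (le_trans h1) //.
  by rewrite invfM mulrCA [C * _]mulrC -[_ * C]mulrA mulVf ?mulr1 // lt0r_neq0.
split=> // i; split=> //; split=> //.
apply/continuous_dist => x e e0.
have e1 : 0 < e / 3 / C by rewrite !divr_gt0.
have [v [hv pv _ gv]] := wg _ e1.
have close y : `|partial i w y - partial i v y| <= e / 3.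
  have dv : derivable v y 'e_i by exact: (Ck_derivable hv).
  have c1 : h^-1 *: ((v \o shift y) (h *: 'e_i) - v y) @[h --> (0 : R)^'] --> partial i v y by exact: dv.
  have c2 : Q i y h @[h --> (0 : R)^'] --> partial i w y by exact: dw.
  have c3 : `|Q i y h - h^-1 *: ((v \o shift y) (h *: 'e_i) - v y)| @[h --> (0 : R)^'] -->
    `|partial i w y - partial i v y| by exact: cvg_norm (cvgB c2 c1).
  apply: (@cvgr_to_le _ _ _ R _ _ _ c3).
  apply: filterS (QE v i y _ hv pv e1 gv) => h.
  by rewrite [C * _]mulrC divfK // lt0r_neq0.
have e3 : 0 < e / 3 by lra.
have /continuous_dist/(_ x _ e3) := Ck_continuous (Ck_partial hv i).
apply: filterS => y vxy.
have := close x; have := close y; move: vxy.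
move: (partial i w x) (partial i w y) (partial i v x) (partial i v y) => A B A' B' h1 h2 h3.
rewrite (_ : A - B = (A - A') + (A' - B') - (B - B')); last by ring.
rewrite (le_lt_trans (ler_normB _ _)) //.
rewrite (le_lt_trans (lerD (ler_normD _ _) (lexx _))) //; lra.
Unshelve. all: by end_near. Qed.

Lemma approx_sol_limit w g :
  (forall e : R, 0 < e -> exists w' g', [/\ approx_sol w' g',
     forall x, `|w x - w' x| <= e & forall x, `|g x - g' x| <= e]) -> approx_sol w g.
Proof.
move=> h e e0; have e2 : 0 < e / 2 by lra.
have [w' [g' [s' ww' gg']]] := h _ e2.
have [v [hv pv wv gv]] := s' _ e2.
exists v; split=> // x.
  rewrite (_ : w x - v x = (w x - w' x) + (w' x - v x)); last by ring.
  by rewrite (le_trans (ler_normD _ _)) // [e]splitr lerD.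
rewrite (_ : g x - elliptic v x = (g x - g' x) + (g' x - elliptic v x)); last first.
  by move: (elliptic v x) => *; ring.
by rewrite (le_trans (ler_normD _ _)) // [e]splitr lerD.
Qed.

(** [elliptic] is linear and commutes with translations; approximating within [e * |h| / 2] absorbs
    the division by [h]. *)
Lemma approx_sol_difference w g (i : 'I_n) (h : R) : h != 0 -> approx_sol w g ->
  approx_sol (fun x => h^-1 * (w (x + h *: 'e_i) - w x)) (fun x => h^-1 * (g (x + h *: 'e_i) - g x)).
Proof.
move=> h0 wg e e0.
have d0 : 0 < e * `|h| / 2 by rewrite divr_gt0 // mulr_gt0 // normr_gt0.
have [v [hv pv wv gv]] := wg _ d0.
have hs := Ck_shift (h *: 'e_i) hv.
have bound (A B : R) : `|A| <= e * `|h| / 2 -> `|B| <= e * `|h| / 2 -> `|h^-1 * (A - B)| <= e.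
  move=> hA hB; rewrite normrM normfV ler_pdivrMl ?normr_gt0 // (le_trans (ler_normB _ _)) //.
  by rewrite (le_trans (lerD hA hB)) // -splitr mulrC.
exists (fun x => h^-1 * (v (x + h *: 'e_i) - v x)); split.
- exact: Ck_scale (Ck_sub hs hv).
- by move=> m x; rewrite addrAC !pv.
- move=> x; rewrite -mulrBr (_ : _ - _ = (w (x + h *: 'e_i) - v (x + h *: 'e_i)) - (w x - v x)).
    exact: bound.
  by ring.
- move=> x; rewrite (ellipticZ _ _ _ _ _ (Ck_sub hs hv)) (ellipticB _ _ _ _ hs hv) (elliptic_shift _ _ _ _ _ hv).
  rewrite -mulrBr (_ : _ - _ = (g (x + h *: 'e_i) - elliptic v (x + h *: 'e_i)) - (g x - elliptic v x)).
    exact: bound.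
  by move: (elliptic v _) (elliptic v x) => *; ring.
Qed.

Lemma Zperiodic_partial f i : Ck 1 f -> Zperiodic f -> Zperiodic (partial i f).
Proof.
move=> hf pf m x; have := partial_shift i (map_mx intr m) hf.
rewrite (_ : (fun x => f (x + _)) = f); last by apply/funext => y; rewrite pf.
by move=> /(congr1 (fun u => u x)).
Qed.

(** By the mean value theorem the quotient is a value of [partial i f] at distance less than [h]
    along the axis; uniform continuity of [partial i f] makes the estimate independent of [x]. *)
Lemma uniform_difference_quotient f (i : 'I_n) (e : R) : Ck 1 f -> Zperiodic f -> 0 < e ->
  \forall h \near (0 : R)^'+, forall x, `|partial i f x - h^-1 * (f (x + h *: 'e_i) - f x)| <= e.
Proof.
move=> hf pf e0.
have := Zperiodic_unif_continuous (Ck_continuous (Ck_partial hf i)) (Zperiodic_partial i hf pf) e0.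
move=> H.
have : \forall h \near (0 : R), forall x, `|partial i f (x + h *: 'e_i) - partial i f x| < e.
  have := @near_line _ _ 0 'e_i _ H; apply: filterS => h H' x.
  by have := H' x; rewrite addr0.
move=> /nbhs_normP[d /= d0 dP].
near=> h => x.
have h0 : 0 < h by near: h; exact: nbhs_right_gt.
have hd : h < d by near: h; exact: nbhs_right_lt.
have dl (t : R) : is_derive t 1 (fun s : R => f (s *: 'e_i + x)) (partial i f (t *: 'e_i + x)).
  by apply/is_derive_line; exact: Ck_is_derive hf _ _.
have [|c] := @MVT _ (fun s : R => f (s *: 'e_i + x)) (fun t => partial i f (t *: 'e_i + x)) 0 h h0.
  by apply: derivable_within_continuous => t _; have [] := dl t.
rewrite in_itv /= scale0r add0r subr0 => /andP[c0 c1] E.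
rewrite [x + _]addrC E mulrC mulfK ?lt0r_neq0 // distrC [c *: _ + x]addrC.
apply/ltW; apply: dP; rewrite /= sub0r normrN gtr0_norm //; exact: lt_trans c1 hd.
Unshelve. all: by end_near. Qed.

(** Difference quotients of [w] and of [q * w] converge uniformly once [w] is C^1, so [partial i w]
    is itself an [approx_sol], with right-hand side [partial i (q * w)]. *)
Lemma approx_sol_Ck2 w q : Ck 1 q -> Zperiodic q -> Zperiodic w ->
  approx_sol w (fun x => q x * w x) -> Ck 2 w.
Proof.
move=> hq pq pw ws; have hw := approx_sol_Ck1 ws.
have hg := Ck_mul hq hw.
have pg : Zperiodic (fun x => q x * w x) by move=> m x; rewrite pq pw.
apply: (@CkS _ _ _ _ (fun i => partial i w)).
- exact: Ck_continuous hw.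
- by move=> i x; exact: Ck_is_derive hw _ _.
- move=> i; apply: (@approx_sol_Ck1 _ (partial i (fun x => q x * w x))).
  apply: approx_sol_limit => e e0.
  have D1 := uniform_difference_quotient i hw pw e0.
  have D2 := uniform_difference_quotient i hg pg e0.
  have [h [[h0 h1] h2]] := filter_ex (filterI (filterI (nbhs_right_gt 0) D1) D2).
  exists (fun x => h^-1 * (w (x + h *: 'e_i) - w x)).
  exists (fun x => h^-1 * (q (x + h *: 'e_i) * w (x + h *: 'e_i) - q x * w x)).
  split=> //.
  exact: (approx_sol_difference i (lt0r_neq0 h0) ws).
Qed.

End Approximation.

(** * Trigonometric approximation *)

Section Fejer.
Context {R : realType}.
Implicit Types (t x c : R).

Lemma cos_shift_int (m : int) t : cos (t + 2 * pi * m%:~R) = cos t.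
Proof.
have pos (l : nat) (s : R) : cos (s + 2 * pi * l%:R) = cos s.
  have -> : 2 * pi * l%:R = (pi *+ 2) *+ l :> R by rewrite mulr_natr mulr_natl.
  exact: (periodicn (@cosD2pi R)).
case: m => l; first by rewrite -pmulrn pos.
rewrite NegzE rmorphN /= -pmulrn mulrN.
by rewrite -[in RHS](subrK (2 * pi * l.+1%:R) t) pos.
Qed.

Lemma sin_shift_int (m : int) t : sin (t + 2 * pi * m%:~R) = sin t.
Proof. by rewrite -!cosBpihalf addrAC cos_shift_int. Qed.

Lemma mul2_cos x t : 2 * (cos x * cos t) = cos (x + t) + cos (x - t).
Proof. rewrite cosD cosB; ring. Qed.

(** Multiplied by [2 * sin (s / 2)], the sum telescopes, and its endpoints differ by
    [M * s = 2 * pi * d], a whole number of turns. The bounds on [d] put [s / 2] strictly between 0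
    and [pi], so the factor can be cancelled. *)
Lemma sum_cos_grid (M d : nat) c : (0 < d < M)%N ->
  \sum_(l < M) cos (c - l%:R * (2 * pi * d%:R / M%:R)) = 0.
Proof.
move=> /andP[d0 dM].
have M0 : 0 < M%:R :> R by rewrite ltr0n (leq_trans d0 (ltnW dM)).
set s := 2 * pi * d%:R / M%:R.
have sins : sin (s / 2) != 0.
  apply/lt0r_neq0/sin_gt0_pi.
  have -> : s / 2 = pi * (d%:R / M%:R) by rewrite /s; field; exact: lt0r_neq0.
  have dM0 : 0 < d%:R / M%:R :> R by rewrite divr_gt0 // ltr0n.
  have dM1 : d%:R / M%:R < 1 :> R by rewrite ltr_pdivrMr // mul1r ltr_nat.
  by rewrite mulr_gt0 ?pi_gt0 //= gtr_pMr ?pi_gt0.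
have tel (m : nat) : 2 * sin (s / 2) * \sum_(l < m) cos (c - l%:R * s) =
    sin (c + s / 2) - sin (c + s / 2 - m%:R * s).
  elim: m => [|m IH]; first by rewrite big_ord0 mul0r subr0 mulr0 subrr.
  rewrite big_ord_recr /= mulrDr IH.
  have -> : c + s / 2 - m%:R * s = (c - m%:R * s) + s / 2 by ring.
  have -> : c + s / 2 - m.+1%:R * s = (c - m%:R * s) - s / 2.
    by rewrite -[m.+1%:R]natr1; field.
  rewrite (sinD (c - m%:R * s)) (sinB (c - m%:R * s)); ring.
have := tel M; have -> : c + s / 2 - M%:R * s = (c + s / 2) + 2 * pi * (- d%:Z)%:~R.
  rewrite /s rmorphN /= -pmulrn; field; exact: lt0r_neq0.
rewrite sin_shift_int subrr => /eqP; rewrite mulf_eq0 mulf_eq0 (negbTE sins) pnatr_eq0 /=.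
by move/eqP.
Qed.

Definition grid_angle (M : nat) x (l : nat) : R := 2 * pi * (x - l%:R / M%:R).

(** Discrete orthogonality: with [p] and [q] below [M], the frequency [p - q] is a multiple of [M]
    only when it is zero. *)
Lemma sum_cos_grid_diff (M p q : nat) x : (p < M)%N -> (q < M)%N ->
  \sum_(l < M) cos ((p%:R - q%:R) * grid_angle M x l) = (M * (p == q))%:R.
Proof.
wlog qp : p q / (q <= p)%N => [h pM qM|pM qM].
  have [qp|/ltnW pq] := leqP q p; first exact: h.
  rewrite eq_sym -h //; apply: eq_bigr => l _.
  by rewrite -[LHS]cosN -mulNr opprB.
have [->|pq] := eqVneq p q.
  rewrite muln1 (eq_bigr (fun=> 1)) => [|l _]; last by rewrite subrr mul0r cos0.
  by rewrite sumr_const card_ord.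
rewrite muln0 -[RHS](@sum_cos_grid M (p - q) ((p%:R - q%:R) * (2 * pi * x))).
  apply: eq_bigr => l _; congr cos; rewrite /grid_angle natrB //; ring.
by rewrite subn_gt0 ltn_neqAle eq_sym pq qp /= (leq_ltn_trans (leq_subr _ _) pM).
Qed.

(* This is [N^-1 * |\sum_(p < N) exp (i p t)|^2]; its moments over the N + 1 grid points
   are exact because all the frequencies involved are smaller than the number of points. *)
Definition fejer (N : nat) t : R :=
  N%:R^-1 * \sum_(p < N) \sum_(q < N) cos ((p%:R - q%:R) * t).

Lemma fejer_ge0 N t : 0 <= fejer N t.
Proof.
rewrite /fejer mulr_ge0 ?invr_ge0 ?ler0n //.
have -> : \sum_(p < N) \sum_(q < N) cos ((p%:R - q%:R) * t) =
    (\sum_(p < N) cos (p%:R * t)) ^+ 2 + (\sum_(p < N) sin (p%:R * t)) ^+ 2.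
  rewrite !expr2 !big_distrl -big_split /=; apply: eq_bigr => p _.
  rewrite !big_distrr -big_split /=; apply: eq_bigr => q _.
  by rewrite mulrBl cosB.
by rewrite addr_ge0 ?sqr_ge0.
Qed.

Lemma sum_fejer N x : \sum_(l < N.+2) fejer N.+1 (grid_angle N.+2 x l) = N.+2%:R.
Proof.
rewrite -mulr_sumr exchange_big /=.
rewrite (eq_bigr (fun=> N.+2%:R)) => [|p _]; last first.
  rewrite exchange_big /= (bigD1 p) //= sum_cos_grid_diff ?eqxx ?muln1; do ?[exact: leqW].
  rewrite big1 ?addr0 // => q qp.
  rewrite sum_cos_grid_diff; do ?[exact: leqW].
  by rewrite eq_sym (negbTE (qp : (q != p :> nat))) muln0.
by rewrite sumr_const card_ord -[X in _ * X]mulr_natl mulKf // pnatr_eq0.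
Qed.

(** The cosine shifts the frequency [p - q] by one either way, so only the [2 * N] ordered pairs of
    neighbouring indices survive. The shifted indices reach [N.+1], whence [N.+2] nodes. *)
Lemma sum_fejer_cos N x :
  \sum_(l < N.+2) fejer N.+1 (grid_angle N.+2 x l) * cos (grid_angle N.+2 x l) =
  N.+2%:R * (N%:R / N.+1%:R).
Proof.
pose C p q l := cos ((p%:R - q%:R) * grid_angle N.+2 x l).
have E (l : 'I_N.+2) : fejer N.+1 (grid_angle N.+2 x l) * cos (grid_angle N.+2 x l) =
   (2 * N.+1%:R)^-1 * \sum_(p < N.+1) \sum_(q < N.+1) (C p.+1 q l + C p q.+1 l).
  rewrite /fejer invfM [2^-1 * _]mulrC -!mulrA; congr (_ * _).
  rewrite mulr_suml mulr_sumr; apply: eq_bigr => p _.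
  rewrite mulr_suml mulr_sumr; apply: eq_bigr => q _ /=.
  have two0 : (2 : R) != 0 by rewrite pnatr_eq0.
  apply: (mulfI two0); rewrite mul2_cos mulVKf //.
  by rewrite /C -[p.+1%:R]natr1 -[q.+1%:R]natr1; congr (cos _ + cos _); ring.
rewrite (eq_bigr _ (fun l _ => E l)) -mulr_sumr exchange_big /=.
have b1 (p : 'I_N.+1) : (p < N.+2)%N by exact: leqW (ltn_ord p).
have b2 (p : 'I_N.+1) : (p.+1 < N.+2)%N by rewrite ltnS ltn_ord.
have delta (p q : 'I_N.+1) : \sum_(l < N.+2) (C p.+1 q l + C p q.+1 l) =
    N.+2%:R * ((p.+1 == q)%:R + (p == q.+1 :> nat)%:R).
  rewrite big_split /= (sum_cos_grid_diff _ (b2 p) (b1 q)).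
  by rewrite (sum_cos_grid_diff _ (b1 p) (b2 q)) !natrM mulrDr.
have cnt (p : 'I_N.+1) : \sum_(q < N.+1) (p.+1 == q)%:R = (p < N)%:R :> R.
  have [pN|pN] := boolP (p < N)%N.
    rewrite (bigD1 (Ordinal (pN : (p.+1 < N.+1)%N))) //= eqxx big1 ?addr0 // => q.
    by rewrite -val_eqE /= eq_sym => /negbTE ->.
  rewrite big1 // => q _; case: eqP => // pq.
  by move: pN; rewrite -ltnS pq ltn_ord.
have tot : \sum_(p < N.+1) (p < N)%:R = N%:R :> R.
  rewrite big_ord_recr /= ltnn addr0 (eq_bigr (fun=> 1)) => [|p _]; last by rewrite ltn_ord.
  by rewrite sumr_const card_ord.
rewrite (eq_bigr (fun p : 'I_N.+1 => \sum_(q < N.+1) N.+2%:R * ((p.+1 == q)%:R + (p == q.+1 :> nat)%:R))); last first.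
  by move=> p _; rewrite exchange_big; apply: eq_bigr => q _; exact: delta.
have -> : \sum_(p < N.+1) \sum_(q < N.+1) N.+2%:R * ((p.+1 == q)%:R + (p == q.+1 :> nat)%:R) =
    N.+2%:R * (2 * N%:R) :> R.
  under eq_bigr do rewrite -mulr_sumr big_split /=.
  rewrite -mulr_sumr big_split /=; congr (_ * _).
  rewrite (eq_bigr _ (fun p _ => cnt p)) tot exchange_big /=.
  rewrite (eq_bigr (fun q : 'I_N.+1 => (q < N)%:R)) => [|q _].
    by rewrite tot; ring.
  by rewrite -cnt; apply: eq_bigr => p _; rewrite eq_sym.
by field; rewrite !nat1r !pnatr_eq0.
Qed.

End Fejer.

(** * Trigonometric polynomials and explicit solutions of the constant coefficient equation *)

Section TrigPoly.
Context {R : realType} {n : nat}.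
Implicit Types (f g w : 'rV[R]_n -> R) (x y : 'rV[R]_n) (m : 'rV[int]_n).

Definition phase m (c : R) x : R := 2 * pi * dot (map_mx intr m) x + c.

Lemma phaseD m m' c c' x : phase (m + m') (c + c') x = phase m c x + phase m' c' x.
Proof. by rewrite /phase map_mxD dotDl mulrDr addrACA. Qed.

Lemma phaseN m c x : phase (- m) (- c) x = - phase m c x.
Proof. by rewrite /phase map_mxN -scaleN1r dotZl mulN1r mulrN opprD. Qed.

(** The free phase [c] makes sines a case of cosines, so the product-to-sum formula for two cosines
    gives closure under multiplication. *)
Inductive trigpoly : ('rV[R]_n -> R) -> Prop :=
| trigpoly_cos m c : trigpoly (fun x => cos (phase m c x))
| trigpoly_add f g : trigpoly f -> trigpoly g -> trigpoly (fun x => f x + g x)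
| trigpoly_scale (c : R) f : trigpoly f -> trigpoly (fun x => c * f x).

Lemma trigpoly_cst (c : R) : trigpoly (fun=> c).
Proof.
have := trigpoly_scale c (trigpoly_cos 0 0); congr trigpoly; apply/funext => x.
rewrite /phase (_ : map_mx intr 0 = 0) 1?dotC ?dot0r ?mulr0 ?addr0 ?cos0 ?mulr1 //.
by apply/rowP => i; rewrite !mxE.
Qed.

Lemma trigpoly_sum (I : finType) (F : I -> 'rV[R]_n -> R) :
  (forall i, trigpoly (F i)) -> trigpoly (fun x => \sum_i F i x).
Proof.
move=> hF; elim: (index_enum I) => [|i s IH].
  have := trigpoly_cst 0; congr trigpoly; apply/funext => x; by rewrite big_nil.
have := trigpoly_add (hF i) IH; congr trigpoly; apply/funext => x; by rewrite big_cons.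
Qed.

Lemma trigpoly_mul_cos f m c : trigpoly f -> trigpoly (fun x => f x * cos (phase m c x)).
Proof.
elim=> [m' c'|g h _ IHg _ IHh|d g _ IHg].
- have := trigpoly_scale 2^-1 (trigpoly_add (trigpoly_cos (m' + m) (c' + c))
    (trigpoly_cos (m' - m) (c' - c))).
  congr trigpoly; apply/funext => x.
  have two0 : (2 : R) != 0 by rewrite pnatr_eq0.
  apply: (mulfI two0); rewrite mul2_cos mulVKf //.
  by rewrite !phaseD phaseN.
- have := trigpoly_add IHg IHh; congr trigpoly; apply/funext => x; by rewrite mulrDl.
- have := trigpoly_scale d IHg; congr trigpoly; apply/funext => x; by rewrite mulrA.
Qed.

Lemma phase_shift m c m' x : phase m c (x + map_mx intr m') =
  phase m c x + 2 * pi * (\sum_i m 0 i * m' 0 i)%:~R.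
Proof.
rewrite /phase dotDr mulrDr addrAC; congr (_ + 2 * pi * _).
by rewrite rmorph_sum; apply: eq_bigr => i _; rewrite !mxE rmorphM.
Qed.

Lemma partial_phase m c i x : partial i (phase m c) x = 2 * pi * (m 0 i)%:~R.
Proof.
apply: partial_eq; rewrite /phase.
have := @is_deriveD _ _ _ _ _ x (delta_mx 0 i) _ _
  (@is_deriveZ _ _ _ _ (2 * pi) x (delta_mx 0 i) _ (is_derive_dot (map_mx intr m) i x))
  (is_derive_cst c x (delta_mx 0 i)).
by rewrite mxE addr0.
Qed.

Lemma Ck_phase k m c : Ck k (phase m c).
Proof. by apply: Ck_add; [apply: Ck_scale; exact: Ck_dot|exact: Ck_cst]. Qed.

Variables (a k : R) (b : 'rV[R]_n).
Hypotheses (a0 : 0 < a) (k0 : 0 < k).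

(** By linearity one cosine suffices. The operator multiplies [exp (i t)] by its symbol [K + i be],
    which is nonzero since [K >= k > 0]; the solution [w] is the real part of
    [exp (i t) / (K + i be)]. *)
Lemma trigpoly_solvable g : trigpoly g ->
  exists w, [/\ Ck 2 w, Zperiodic w & forall x, elliptic a k b w x = g x].
Proof.
elim=> [m c|f h _ [u [hu pu eu]] _ [v [hv pv ev]]|d f _ [u [hu pu eu]]]; last 2 first.
- exists (fun x => u x + v x); split; first exact: Ck_add.
    by move=> m x; rewrite pu pv.
  by move=> x; rewrite (ellipticD _ _ _ _ hu hv) eu ev.
- exists (fun x => d * u x); split; first exact: Ck_scale.
    by move=> m x; rewrite pu.
  by move=> x; rewrite (ellipticZ _ _ _ _ _ hu) eu.
pose t := phase m c; pose mu i : R := 2 * pi * (m 0 i)%:~R.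
have ht j : Ck j t by exact: Ck_phase.
pose q := \sum_i mu i ^+ 2; pose be := \sum_i b 0 i * mu i.
have q0 : 0 <= q by apply: sumr_ge0 => i _; exact: sqr_ge0.
pose K := k + a * q.
have K0 : 0 < K by rewrite ltr_pwDl // mulr_ge0 // ltW.
pose D := K ^+ 2 + be ^+ 2.
have D0 : 0 < D by rewrite ltr_pwDl ?sqr_ge0 // exprn_gt0.
pose w x := K / D * cos (t x) + be / D * sin (t x).
have hcs j := @Ck_cos_sin R n j t (ht j).
have pt i : partial i t = fun=> mu i by apply/funext => x; exact: partial_phase.
have pw1 (A B : R) i : partial i (fun x => A * cos (t x) + B * sin (t x)) =
    fun x => (B * mu i) * cos (t x) + (- (A * mu i)) * sin (t x).
  have [hc hs] := hcs 1%N.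
  rewrite (partial_add i (Ck_scale A hc) (Ck_scale B hs)) (partial_scale i A hc) (partial_scale i B hs).
  rewrite (partial_cos i (ht 1%N)) (partial_sin i (ht 1%N)) pt.
  by apply/funext => x; ring.
have hw : Ck 2 w by have [hc hs] := hcs 2%N; apply: Ck_add; exact: Ck_scale.
exists w; split=> //.
  by move=> m' x; rewrite /w /t phase_shift cos_shift_int sin_shift_int.
move=> x; rewrite /elliptic laplacianE.
have -> : \sum_i partial i (partial i w) x = - q * w x.
  rewrite mulNr mulr_suml -sumrN; apply: eq_bigr => i _.
  by rewrite /w !pw1; ring.
have -> : dot b (grad w x) = be * (be / D * cos (t x) - K / D * sin (t x)).
  rewrite mulr_suml; apply: eq_bigr => i _.
  by rewrite mxE /w pw1; ring.
have -> : k * w x - a * (- q * w x) = K * w x by rewrite /K; ring.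
have -> : cos (phase m c x) = D / D * cos (t x) by rewrite divff ?mul1r // lt0r_neq0.
by rewrite /w /D; field; exact: lt0r_neq0.
Qed.

End TrigPoly.

(** * Uniform approximation by trigonometric polynomials *)

Section Density.
Context {R : realType} {n : nat}.
Implicit Types (f g w : 'rV[R]_n -> R) (x y : 'rV[R]_n) (m : 'rV[int]_n).

(** Either every [x 0 i - y 0 i] is close to an integer, and uniform continuity with periodicity
    gives [e]; or one summant is at least some [c > 0], and the crude bound [2 * M] is absorbed by
    [B = 2 * M / c]. The right-hand side is a quantity whose Fejer averages are known exactly. *)
Lemma modulus_cos f (e : R) : continuous f -> Zperiodic f -> 0 < e ->
  exists2 B, 0 < B & forall x y,
    `|f x - f y| <= e + B * \sum_i (1 - cos (2 * pi * (x 0 i - y 0 i))).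
Proof.
move=> cf pf e0.
have [M M0 fM] := Zperiodic_bounded cf pf.
have /nbhs_normP[d /= d0 dP] := Zperiodic_unif_continuous cf pf e0.
(* The bound [1 / 4] keeps [2 * pi * r] in the interval where the cosine decreases. *)
pose r := Num.min (d / 2) (1 / 4).
have r0 : 0 < r by rewrite lt_min !divr_gt0.
have rd : r < d.
  have : r <= d / 2 by rewrite ge_min lexx.
  lra.
have r4 : r <= 1 / 4 by rewrite ge_min lexx orbT.
have pi0 := pi_gt0 R.
have rpi : 2 * pi * r \in `[0, (pi : R)].
  rewrite in_itv /=; apply/andP; split; first by rewrite !mulr_ge0 // ltW.
  have : pi * r <= pi * (1 / 4) by rewrite ler_pM2l.
  rewrite -mulrA; lra.
pose c := 1 - cos (2 * pi * r).
have c0 : 0 < c.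
  rewrite subr_gt0 -[ltRHS]cos0 ltr_cos ?mulr_gt0 //.
  by rewrite in_itv /= lexx ltW.
exists (2 * M / c); first by rewrite divr_gt0 // mulr_gt0.
move=> x y.
have pos i : 0 <= 1 - cos (2 * pi * (x 0 i - y 0 i)) by rewrite subr_ge0 cos_le1.
have S0 : 0 <= \sum_i (1 - cos (2 * pi * (x 0 i - y 0 i))) by apply: sumr_ge0.
have [/existsP[i hi]|/existsPn hn] := boolP [exists i, c <= 1 - cos (2 * pi * (x 0 i - y 0 i))].
  have : c <= \sum_i (1 - cos (2 * pi * (x 0 i - y 0 i))).
    by rewrite (bigD1 i) //= (le_trans hi) // lerDl sumr_ge0.
  move=> cS; apply: (@le_trans _ _ (2 * M)).
    by rewrite (le_trans (ler_normB _ _)) // mulr_natl mulr2n lerD.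
  rewrite -[leLHS]add0r lerD ?(ltW e0) // mulrAC ler_pdivlMr //.
  by rewrite ler_pM2l ?mulr_gt0.
(* Rounding to the nearest integer gives [|h 0 i| <= 1 / 2], so that the cosine determines the size
   of [|h 0 i|]. *)
pose m : 'rV[int]_n := \row_i - Num.floor (x 0 i - y 0 i + 1 / 2).
pose h := (x + map_mx intr m) - y.
have hE i : h 0 i = x 0 i - y 0 i - (Num.floor (x 0 i - y 0 i + 1 / 2))%:~R.
  by rewrite !mxE rmorphN /= addrAC.
have hr i : `|h 0 i| < r.
  have := floor_itv (x 0 i - y 0 i + 1 / 2); rewrite rmorphD rmorph1 => fl.
  have h12 : `|h 0 i| <= 1 / 2 by rewrite hE ler_norml; lra.
  have := hn i; rewrite -ltNge ltrD2l ltrN2.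
  have -> : cos (2 * pi * (x 0 i - y 0 i)) = cos (2 * pi * `|h 0 i|).
    have -> : 2 * pi * `|h 0 i| = `|2 * pi * h 0 i|.
      by rewrite normrM ger0_norm // mulr_ge0 // ltW.
    rewrite cos_norm -[in RHS](cos_shift_int (Num.floor (x 0 i - y 0 i + 1 / 2))).
    by congr cos; rewrite hE; ring.
  rewrite ltr_cos //; first by rewrite ltr_pM2l // mulr_gt0.
  rewrite in_itv /= !mulr_ge0 ?(ltW pi0) //=.
  have : pi * `|h 0 i| <= pi * (1 / 2) by rewrite ler_pM2l.
  rewrite -mulrA; lra.
have hd : `|h| < d.
  rewrite /Num.norm /= mx_normrE; apply/bigmax_ltP; split=> // -[i j] _ /=.
  by rewrite ord1 (lt_trans (hr j)).
have := dP h; rewrite /= sub0r normrN => /(_ hd y).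
rewrite /h [y + _]addrC subrK pf => /ltW/le_trans; apply.
by rewrite lerDl mulr_ge0 // divr_ge0 ?mulr_ge0 // ltW.
Qed.

(** A Korovkin-type argument: the [K l x] are nonnegative weights of sum 1, products of
    one-dimensional Fejer kernels, and the average of each [1 - cos] is exactly [1 / N.+1].
    Averaging [modulus_cos] over the nodes bounds the error by [e / 2 + B * n / N.+1]. *)
Lemma trigpoly_dense f (e : R) : continuous f -> Zperiodic f -> 0 < e ->
  exists2 g, trigpoly g & forall x, `|f x - g x| <= e.
Proof.
move=> cf pf e0.
have [|B B0 fB] := modulus_cos cf pf (e := e / 2); first by lra.
have e2 : 0 < e / 2 by lra.
pose N := Num.truncn ((e / 2)^-1 * (B * n%:R)).
have NP : B * (n%:R / N.+1%:R) <= e / 2.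
  rewrite mulrA ler_pdivrMr ?ltr0n // -ler_pdivrMl //.
  by apply/ltW; exact: truncnS_gt.
pose node (l : {ffun 'I_n -> 'I_N.+2}) : 'rV[R]_n := \row_i ((l i)%:R / N.+2%:R).
pose F1 (t : R) (l : nat) := fejer N.+1 (grid_angle N.+2 t l) / N.+2%:R.
pose K (l : {ffun 'I_n -> 'I_N.+2}) x := \prod_i F1 (x 0 i) (l i).
have F10 t l : 0 <= F1 t l by rewrite divr_ge0 // fejer_ge0.
have K0 l x : 0 <= K l x by apply: prodr_ge0 => i _; exact: F10.
have F1S t : \sum_(l < N.+2) F1 t l = 1.
  by rewrite -mulr_suml sum_fejer divff // pnatr_eq0.
have F1C t : \sum_(l < N.+2) F1 t l * (1 - cos (grid_angle N.+2 t l)) = N.+1%:R^-1.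
  under eq_bigr do rewrite mulrBr mulr1.
  rewrite sumrB F1S.
  have -> : \sum_(l < N.+2) F1 t l * cos (grid_angle N.+2 t l) =
     (\sum_(l < N.+2) fejer N.+1 (grid_angle N.+2 t l) * cos (grid_angle N.+2 t l)) / N.+2%:R.
    by rewrite mulr_suml; apply: eq_bigr => l _; rewrite mulrAC.
  rewrite sum_fejer_cos [_ * (_ / _)]mulrC mulfK ?pnatr_eq0 //.
  by rewrite -[N.+1%:R]natr1; field; rewrite natr1 pnatr_eq0.
have KS x : \sum_l K l x = 1.
  rewrite -(bigA_distr_bigA (fun i (j : 'I_N.+2) => F1 (x 0 i) j)).
  by rewrite big1 // => i _; exact: F1S.
have KC x i : \sum_l K l x * (1 - cos (2 * pi * (x 0 i - node l 0 i))) = N.+1%:R^-1.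
  (* The weight is put into the factor of coordinate [i], so that the sum over the grid factors into
     one-dimensional sums, all equal to 1 except that one. *)
  pose G j (l : 'I_N.+2) := F1 (x 0 j) l * (if j == i then 1 - cos (grid_angle N.+2 (x 0 j) l) else 1).
  have -> : \sum_l K l x * (1 - cos (2 * pi * (x 0 i - node l 0 i))) =
      \sum_(l : {ffun 'I_n -> 'I_N.+2}) \prod_j G j (l j).
    apply: eq_bigr => l _; rewrite /G big_split /=; congr (_ * _).
    rewrite (bigD1 i) //= eqxx big1 ?mulr1; first by rewrite mxE.
    by move=> j /negbTE ->.
  rewrite -(bigA_distr_bigA G) (bigD1 i) //= [X in _ * X]big1 => [|j ji].
    by rewrite mulr1 -(F1C (x 0 i)); apply: eq_bigr => l _; rewrite /G eqxx.
  by rewrite -(F1S (x 0 j)); apply: eq_bigr => l _; rewrite /G (negbTE ji) mulr1.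
exists (fun x => \sum_l f (node l) * K l x).
  apply: trigpoly_sum => l; apply: trigpoly_scale; rewrite /K.
  (* Multiplying in one coordinate at a time: each Fejer factor is a double sum of cosines of
     integer frequency [p - q] along axis [i], the node entering only as a phase. *)
  elim: (index_enum _) => [|i s IH].
    rewrite (_ : (fun x => _) = fun=> 1); first exact: trigpoly_cst.
    by apply/funext => x; rewrite big_nil.
  rewrite (_ : (fun x => _) = fun x => \sum_(p < N.+1) \sum_(q < N.+1)
      (N.+2%:R^-1 * N.+1%:R^-1) * ((\prod_(j <- s) F1 (x 0 j) (l j)) *
        cos (phase (\row_j ((p%:Z - q%:Z) * (j == i)%:Z)) (- (2 * pi * (p%:R - q%:R) * ((l i)%:R / N.+2%:R))) x))).
    apply: trigpoly_sum => p; apply: trigpoly_sum => q; apply: trigpoly_scale.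
    exact: trigpoly_mul_cos.
  apply/funext => x; rewrite big_cons {1}/F1 /fejer.
  set T := \prod_(j <- s) _; set S := \sum_(p < _) _.
  have -> : N.+1%:R^-1 * S / N.+2%:R * T = (N.+2%:R^-1 * N.+1%:R^-1 * T) * S by ring.
  rewrite mulr_sumr; apply: eq_bigr => p _.
  rewrite mulr_sumr; apply: eq_bigr => q _.
  rewrite -[LHS]mulrA; congr (_ * (_ * cos _)).
  rewrite /phase /grid_angle (_ : dot _ x = (p%:R - q%:R) * x 0 i); first by ring.
  rewrite /dot (bigD1 i) //= !mxE eqxx mulr1 rmorphB /= -!pmulrn big1 ?addr0 // => j ji.
  by rewrite !mxE (negbTE ji) mulr0 mul0r.
move=> x.
have -> : f x - \sum_l f (node l) * K l x = \sum_l (f x - f (node l)) * K l x.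
  by under [RHS]eq_bigr do rewrite mulrBl; rewrite sumrB -mulr_sumr KS mulr1.
rewrite (le_trans (ler_norm_sum _ _ _)) //.
apply: (@le_trans _ _ (\sum_l (e / 2 + B * \sum_i (1 - cos (2 * pi * (x 0 i - node l 0 i)))) * K l x)).
  by apply: ler_sum => l _; rewrite normrM (ger0_norm (K0 l x)) ler_wpM2r.
under eq_bigr do rewrite mulrDl -[B * _ * _]mulrA.
rewrite big_split /= -mulr_sumr KS mulr1 -mulr_sumr [leRHS]splitr lerD2l.
apply: le_trans NP; rewrite ler_pM2l //.
under eq_bigr do rewrite mulr_suml.
rewrite exchange_big /= (eq_bigr (fun=> N.+1%:R^-1)) => [|i _].
  by rewrite sumr_const card_ord mulr_natl.
by rewrite -(KC x i); apply: eq_bigr => l _; rewrite mulrC.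
Qed.

Lemma elliptic_dense (a k : R) (b : 'rV[R]_n) g (e : R) : 0 < a -> 0 < k ->
  continuous g -> Zperiodic g -> 0 < e ->
  exists w, [/\ Ck 2 w, Zperiodic w & forall x, `|g x - elliptic a k b w x| <= e].
Proof.
move=> a0 k0 cg pg e0.
have [h th gh] := trigpoly_dense cg pg e0.
have [w [hw pw ew]] := trigpoly_solvable b a0 k0 th.
by exists w; split=> // x; rewrite ew.
Qed.

End Density.

(** * Strong minimum principle *)

Section StrongMinimum.
Context {R : realType} {n : nat}.
Implicit Types (f g w : 'rV[R]_n -> R) (x y : 'rV[R]_n).

(** The square of the Euclidean distance, which is smooth; the bars in [|x - y|] denote the sup
    norm, which it dominates. *)
Definition sqdist y x : R := \sum_i (x 0 i - y 0 i) * (x 0 i - y 0 i).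

Lemma sqdist_ge0 y x : 0 <= sqdist y x.
Proof. by apply: sumr_ge0 => i _; rewrite -expr2 sqr_ge0. Qed.

Lemma Ck_sqdist k y : Ck k (sqdist y).
Proof.
by apply: Ck_sum => i; apply: Ck_mul; apply: Ck_sub; do ?[exact: Ck_coord|exact: Ck_cst].
Qed.

Lemma partial_sqdist y i : partial i (sqdist y) = fun x => 2 * (x 0 i - y 0 i).
Proof.
apply/funext => x; apply: partial_eq; apply/is_derive_line0.
rewrite (_ : (fun _ => _) = fun h : R => h * h + h * (2 * (x 0 i - y 0 i)) + sqdist y x).
  by apply: is_derive_eq; rewrite /GRing.scale /=; ring.
apply/funext => h; rewrite /sqdist (bigD1 i) //= [in RHS](bigD1 i) //= !mxE !eqxx /=.
rewrite (eq_bigr (fun j => (x 0 j - y 0 j) * (x 0 j - y 0 j))) => [|j ji].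
  by rewrite mulr1; ring.
by rewrite !mxE (negbTE ji) andbF mulr0 add0r.
Qed.

Lemma norm_lt_sqdist y x (r : R) : 0 < r -> sqdist y x < r ^+ 2 -> `|x - y| < r.
Proof.
move=> r0 xr; rewrite /Num.norm /= mx_normrE; apply/bigmax_ltP; split=> // -[i j] _ /=.
rewrite ord1 !mxE -(@ltr_pXn2r _ 2) ?nnegrE // ?ltW // -normrX ger0_norm ?sqr_ge0 //.
apply: le_lt_trans xr; rewrite /sqdist (bigD1 j) //= -expr2 lerDl.
by apply: sumr_ge0 => l _; rewrite -expr2 sqr_ge0.
Qed.

Lemma sqdist_eq0 y x : sqdist y x = 0 -> x = y.
Proof.
move=> h; apply/eqP; rewrite -subr_eq0 -normr_eq0 eq_le normr_ge0 andbT.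
apply/ler_addgt0Pr => e e0; rewrite add0r ltW //; apply: norm_lt_sqdist => //.
by rewrite h exprn_gt0.
Qed.

Lemma compact_annulus y (r s : R) : compact [set x | r <= sqdist y x <= s].
Proof.
apply: bounded_closed_compact.
  exists (`|y| + (1 + `|s|)); split; first by rewrite num_real.
  move=> M hM x /= /andP[_ xs]; apply/ltW/(le_lt_trans _ hM).
  rewrite -[x](subrK y) addrC (le_trans (ler_normD _ _)) // lerD2l.
  apply/ltW/norm_lt_sqdist; first by rewrite ltr_pwDl.
  rewrite (le_lt_trans xs) // (le_lt_trans (ler_norm s)) // sqrrD expr1n mul1r.
  by have := normr_ge0 s; have := sqr_ge0 `|s|; move: (`|s|) => t h1 h2; rewrite mulr2n; lra.
have -> : [set x | r <= sqdist y x <= s] = sqdist y @^-1` [set t | r <= t <= s] by [].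
apply: preimage_closed; first by move=> x _; exact: (Ck_continuous (Ck_sqdist 0 y)).
have -> : [set t | r <= t <= s] = `[r, s]%classic.
  by apply/seteqP; split=> t /=; rewrite in_itv.
exact: interval_closed.
Qed.

Variables (a K : R) (b : 'rV[R]_n).
Hypotheses (a0 : 0 < a) (K0 : 0 <= K).

Section Barrier.
Variables (y : 'rV[R]_n) (al : R).
Let T x := expR (- al * sqdist y x).

Lemma Ck_barrier k : Ck k T.
Proof. by apply: Ck_expR; apply: Ck_scale; exact: Ck_sqdist. Qed.

Lemma partial_barrier i : partial i T = fun x => T x * (- (2 * al) * (x 0 i - y 0 i)).
Proof.
rewrite (partial_expR i (Ck_scale (- al) (Ck_sqdist 1 y))).
by apply/funext => x; rewrite (partial_scale i (- al) (Ck_sqdist 1 y)) partial_sqdist /T; ring.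
Qed.

Lemma partial2_barrier i : partial i (partial i T) =
  fun x => T x * (4 * al ^+ 2 * ((x 0 i - y 0 i) * (x 0 i - y 0 i)) - 2 * al).
Proof.
have hc : Ck 1 (fun x => x 0 i - y 0 i) by apply: Ck_sub; [exact: Ck_coord|exact: Ck_cst].
rewrite partial_barrier (partial_mul i (Ck_barrier 1) (Ck_scale _ hc)).
apply/funext => x; rewrite (partial_scale i _ hc) partial_barrier.
rewrite (partial_sub i (Ck_coord 1 i) (Ck_cst 1 _)) partial_cst subr0.
by rewrite (partial_eq (is_derive_coord i i x)) eqxx /=; ring.
Qed.

Lemma barrier_operator x : a * laplacian T x - dot b (grad T x) =
  T x * (a * (4 * al ^+ 2 * sqdist y x - 2 * al * n%:R) + 2 * al * dot b (x - y)).
Proof.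
have -> : laplacian T x = T x * (4 * al ^+ 2 * sqdist y x - 2 * al * n%:R).
  have -> : 2 * al * n%:R = \sum_(i < n) 2 * al by rewrite sumr_const card_ord mulr_natr.
  rewrite laplacianE /sqdist.
  by rewrite mulr_sumr -sumrB mulr_sumr; apply: eq_bigr => i _; rewrite partial2_barrier.
have -> : dot b (grad T x) = T x * (- (2 * al) * dot b (x - y)).
  rewrite /dot !mulr_sumr; apply: eq_bigr => i _.
  by rewrite !mxE partial_barrier; ring.
by ring.
Qed.

End Barrier.

Lemma dot_amgm (p q : 'rV[R]_n) : - dot p q <= dot p p + dot q q.
Proof.
rewrite /dot -sumrN -big_split; apply: ler_sum => i _ /=.
have := sqr_ge0 (p 0 i + q 0 i); have := sqr_ge0 (p 0 i); have := sqr_ge0 (q 0 i).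
rewrite sqrrD !expr2 -mulr_natl => h1 h2 h3; lra.
Qed.

(* If [f y > 0], compare [f] with the barrier
   [d * (exp (- al |x - y|^2) - exp (- al |x0 - y|^2))] on an annulus around [y] having [x0] in
   its interior: the minimum of the difference is nonpositive, so it is interior, and there
   the barrier violates the differential inequality for large [al]. *)
Lemma strong_minimum f x0 : Ck 2 f -> (forall x, 0 <= f x) -> f x0 = 0 ->
  (forall x, a * laplacian f x - dot b (grad f x) <= K * f x) -> forall y, f y = 0.
Proof.
move=> hf f0 fx0 fK y; apply/eqP; rewrite eq_le f0 andbT leNgt; apply/negP => fy.
have fy2 : 0 < f y / 2 by rewrite divr_gt0.
have := (continuous_dist f).1 (Ck_continuous hf) y _ fy2.
move=> /nbhs_normP[r /= r0 rP].
have near_y x : `|x - y| < r -> f y / 2 < f x.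
  move=> xy; have := rP x; rewrite /= distrC => /(_ xy).
  by rewrite ltr_norml => /andP[h1 h2]; lra.
pose S := sqdist y x0.
have S0 : 0 < S.
  rewrite lt_def sqdist_ge0 andbT; apply/eqP => /sqdist_eq0 E.
  by move: fy; rewrite -E fx0 ltxx.
(* Squared inner radius: below [r ^+ 2], so that [f > f y / 2] on the inner sphere, and below [S],
   so that [x0] lies inside the annulus [rho <= sqdist y x <= 2 * S]. *)
pose rho := Num.min (S / 2) (r ^+ 2 / 2).
have rho0 : 0 < rho by rewrite lt_min !divr_gt0 // exprn_gt0.
have rhoS : rho < S.
  have : rho <= S / 2 by rewrite ge_min lexx.
  by lra.
have rhor : rho < r ^+ 2.
  have : rho <= r ^+ 2 / 2 by rewrite ge_min lexx orbT.
  have : 0 < r ^+ 2 by rewrite exprn_gt0.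
  by lra.
(* [B] bounds [- dot b (z - y)] on the annulus, and [al] is large enough for the term in [al ^+ 2]
   of [barrier_operator], at least [4 * a * rho * al ^+ 2], to exceed all the others and [K]. *)
pose B := dot b b + 2 * S.
have B0 : 0 < B by rewrite ltr_wpDl ?mulr_gt0 //; apply: sumr_ge0 => i _; rewrite -expr2 sqr_ge0.
pose al := 1 + (K + 2 * (a * n%:R + B)) / (4 * a * rho).
have D0 : 0 < 4 * a * rho by rewrite !mulr_gt0.
have nB : 0 <= a * n%:R + B by rewrite addr_ge0 ?mulr_ge0 // ltW.
have al1 : 1 <= al by rewrite lerDl divr_ge0 ?(ltW D0) // addr_ge0 // mulr_ge0.
have alP : K + 2 * (a * n%:R + B) < 4 * a * rho * al.
  have -> : 4 * a * rho * al = 4 * a * rho + (K + 2 * (a * n%:R + B)).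
    by rewrite /al; field; rewrite !lt0r_neq0.
  by rewrite ltrDr.
pose T x := expR (- al * sqdist y x).
pose c := expR (- al * S).
pose d := f y / 2.
have T0 x : 0 < T x by exact: expR_gt0.
have T1 x : T x <= 1.
  rewrite /T -expR0 ler_expR mulNr oppr_le0 mulr_ge0 ?sqdist_ge0 //.
  exact: le_trans ler01 al1.
have hT : Ck 2 T by exact: Ck_barrier.
pose E x := f x + (- d) * T x + d * c.
have hdT : Ck 2 (fun x => (- d) * T x) by exact: (Ck_scale (- d) hT).
have hE1 : Ck 2 (fun x => f x + (- d) * T x) by exact: (Ck_add hf hdT).
have hE : Ck 2 E by exact: (Ck_add hE1 (Ck_cst 2 (d * c))).
have Ex0 : E x0 = 0 by rewrite /E fx0 /T -/S -/c; ring.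
have [||z /set_mem/= /andP[zr zS] zmin] :=
    @EVT_min_rV _ _ E [set x | rho <= sqdist y x <= 2 * S] _ (@compact_annulus y rho (2 * S)).
- exists x0; rewrite /= -/S (ltW rhoS) /=; lra.
- by apply: continuous_subspaceT; exact: Ck_continuous hE.
have Ez : E z <= 0.
  rewrite -Ex0; apply: zmin; rewrite inE /= -/S (ltW rhoS) /=; lra.
have c0 : 0 < c by exact: expR_gt0.
have fzT : K * f z <= K * (d * T z).
  apply: ler_wpM2l => //; move: Ez; rewrite /E mulNr.
  have : 0 < d * c by rewrite mulr_gt0.
  move: (d * T z) (d * c) (f z) => u v w h1 h2; lra.
(* On the inner sphere [f > d >= d * T], so [E] would be positive. *)
have zr' : rho < sqdist y z.
  rewrite lt_neqAle zr andbT; apply/eqP => zE.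
  have : f y / 2 < f z.
    by apply: near_y; apply: norm_lt_sqdist => //; rewrite -zE.
  have : d * T z <= d by rewrite ger_pMr.
  have : 0 < d * c by rewrite mulr_gt0.
  move: Ez; rewrite /E mulNr; move: (d * T z) (d * c) (f z) => u v w; rewrite -/d; lra.
have al0 : 0 < al by exact: lt_le_trans ltr01 al1.
(* On the outer sphere, farther from [y] than [x0], [T < c], so [E > f >= 0]. *)
have zS' : sqdist y z < 2 * S.
  rewrite lt_neqAle zS andbT; apply/eqP => zE.
  have : d * T z < d * c.
    rewrite ltr_pM2l // ltr_expR zE !mulNr ltrN2 ltr_pM2l //; lra.
  move: Ez (f0 z); rewrite /E mulNr; move: (d * T z) (d * c) (f z) => u v w; lra.
have zloc : \forall x \near z, E z <= E x.
  have cz : {for z, continuous (sqdist y)} by exact: (Ck_continuous (Ck_sqdist 0 y)).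
  have n1 : \forall x \near z, rho < sqdist y x by exact: (cvgr_gt _ cz).
  have n2 : \forall x \near z, sqdist y x < 2 * S by exact: (cvgr_lt _ cz).
  apply: filterS2 n1 n2 => x h1 h2; apply: zmin.
  by rewrite inE /= (ltW h1) (ltW h2).
have [gE lE] := local_min_grad_laplacian hE zloc.
have gz : grad E z = grad f z + (- d) *: grad T z.
  rewrite (gradD _ (CkW hE1) (Ck_cst 1 _)) (gradD _ (CkW hf) (CkW hdT)) (gradZ _ _ (CkW hT)).
  suff -> : grad (fun=> d * c) z = 0 by rewrite addr0.
  by apply/rowP => i; rewrite mxE partial_cst mxE.
have lz : laplacian E z = laplacian f z + (- d) * laplacian T z.
  rewrite (laplacianD _ hE1 (Ck_cst 2 _)) (laplacianD _ hf hdT) (laplacianZ _ _ hT).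
  suff -> : laplacian (fun=> d * c) z = 0 by rewrite addr0.
  by rewrite laplacianE big1 // => i _; rewrite partial_cst partial_cst.
have gb : dot b (grad f z) = d * dot b (grad T z).
  have : dot b (grad E z) = 0 by rewrite gE dot0r.
  by rewrite gz dotDr dotZr mulNr => /eqP; rewrite subr_eq0 => /eqP.
have ineq : d * (a * laplacian T z - dot b (grad T z)) <= K * f z.
  have arith (lf lT gf gT A : R) : gf = d * gT -> 0 <= lf + - d * lT ->
      a * lf - gf <= A -> d * (a * lT - gT) <= A.
    move=> -> h1; apply: le_trans; rewrite mulrBr lerD2r mulrCA ler_pM2l //.
    by move: h1; rewrite mulNr subr_ge0.
  have lE' : 0 <= laplacian f z + - d * laplacian T z by rewrite -lz.
  exact: (arith _ _ _ _ _ gb lE' (fK z)).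
(* Both sides carry the positive factor [d * T z]; once it is cancelled, only the polynomial
   inequality in [al] that [alP] excludes remains. *)
have main := le_trans ineq fzT.
clear ineq fzT lE gE gz lz gb; move: main.
rewrite (barrier_operator y al z) -/(T z) [K * _]mulrCA ler_pM2l // [K * _]mulrC ler_pM2l //.
have dB : - dot b (z - y) <= B.
  apply: (le_trans (dot_amgm _ _)); rewrite lerD2l.
  apply: le_trans zS; rewrite /dot /sqdist; apply: ler_sum => i _.
  by rewrite !mxE.
have : 2 * al * (- B) <= 2 * al * dot b (z - y).
  by rewrite ler_pM2l ?mulr_gt0 // lerNl.
have : al * (4 * a * rho * al) <= a * (4 * al ^+ 2 * sqdist y z).
  have -> : al * (4 * a * rho * al) = 4 * a * al ^+ 2 * rho by ring.
  have -> : a * (4 * al ^+ 2 * sqdist y z) = 4 * a * al ^+ 2 * sqdist y z by ring.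
  by rewrite ler_pM2l // !mulr_gt0 // exprn_gt0.
have : al * (K + 2 * (a * n%:R + B)) < al * (4 * a * rho * al) by rewrite ltr_pM2l.
have : K <= al * K by rewrite ler_peMl.
rewrite mulrBr.
move: (dot b (z - y)) (sqdist y z) => u v.
rewrite (_ : al * (K + 2 * (a * n%:R + B)) = al * K + 2 * al * (a * n%:R) + 2 * al * B); last by ring.
rewrite (_ : a * (2 * al * n%:R) = 2 * al * (a * n%:R)); last by ring.
rewrite mulrN.
move: (al * K) (2 * al * (a * n%:R)) (2 * al * B) (a * (4 * al ^+ 2 * v)) (2 * al * u)
  (al * (4 * a * rho * al)) => *; lra.
Qed.

End StrongMinimum.

(** * Hopf-Cole transform *)

Section HopfCole.
Context {R : realType} {n : nat}.
Implicit Types (w psi u phi V : 'rV[R]_n -> R) (x P : 'rV[R]_n) (sigma c : R).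

Definition linear_operator sigma P V psi x : R :=
  sigma ^+ 4 / 2 * laplacian psi x - sigma ^+ 2 * dot P (grad psi x)
    + (V x + dot P P / 2) * psi x.

(** Conjugation by the exponential replaces [partial i] by [partial i + q i] with
    [q i = - P 0 i / sigma ^+ 2]. In the square, the cross term gives the drift and [q i ^+ 2] gives
    [dot P P / 2]. *)
Lemma twisted_operatorE sigma P V psi x : 0 < sigma -> Ck 2 psi ->
  twisted_operator sigma P V psi x = linear_operator sigma P V psi x.
Proof.
move=> s0 hpsi; have sn0 := lt0r_neq0 s0.
pose E y := expR (- (dot P y / sigma ^+ 2)).
pose q i : R := - (P 0 i / sigma ^+ 2).
have hL k : Ck k (fun y => - (dot P y / sigma ^+ 2)).
  rewrite (_ : (fun _ => _) = fun y => - (sigma ^- 2 * dot P y)).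
    by apply: Ck_opp; apply: Ck_scale; exact: Ck_dot.
  by apply/funext => y; rewrite mulrC.
have hE k : Ck k E by exact: Ck_expR.
have pE i : partial i E = fun y => q i * E y.
  rewrite (partial_expR i (hL 1%N)); apply/funext => y; rewrite mulrC; congr (_ * _).
  rewrite (_ : (fun _ => _) = fun y => (- sigma ^- 2) * dot P y).
    rewrite (partial_scale i _ (Ck_dot 1 P)) (partial_eq (is_derive_dot P i y)) /q.
    by rewrite mulNr mulrC.
  by apply/funext => z; rewrite mulNr mulrC.
have p1 i (g : 'rV[R]_n -> R) : Ck 1 g ->
    partial i (fun y => E y * g y) = fun y => E y * (partial i g y + q i * g y).
  move=> hg; rewrite (partial_mul i (hE 1%N) hg) pE; apply/funext => y.
  by move: (partial i g y) (E y) (g y) => A B C; ring.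
have p2 i : partial i (partial i (fun y => E y * psi y)) =
    fun y => E y * (partial i (partial i psi) y + 2 * q i * partial i psi y + q i ^+ 2 * psi y).
  have h1 := Ck_partial hpsi i; have h2 := Ck_scale (q i) (CkW hpsi).
  rewrite (p1 i psi (CkW hpsi)) (p1 i _ (Ck_add h1 h2)) (partial_add i h1 h2) (partial_scale i _ (CkW hpsi)).
  apply/funext => y.
  by move: (partial i (partial i psi) y) (partial i psi y) (psi y) (E y) => A B C D; ring.
rewrite /twisted_operator -/(E _) /linear_operator.
have -> : laplacian (fun y => E y * psi y) x = E x * (laplacian psi x
    - 2 / sigma ^+ 2 * dot P (grad psi x) + dot P P / sigma ^+ 4 * psi x).
  rewrite laplacianE laplacianE /dot !mulr_sumr !mulr_suml -sumrN -!big_split /= mulr_sumr.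
  apply: eq_bigr => i _; rewrite p2 mxE /q.
  move: (partial i (partial i psi) x) (partial i psi x) (psi x) (E x) => A B C D.
  by field.
have EE : expR (dot P x / sigma ^+ 2) * E x = 1.
  by rewrite /E expRN divff // gt_eqF // expR_gt0.
have reassoc (X Y Z T : R) : X * Y * (Z * T) = (X * Z) * (Y * T) by ring.
rewrite reassoc EE mul1r.
move: (laplacian psi x) (dot P (grad psi x)) (dot P P) (psi x) (V x) => A B C D F.
by field.
Qed.

Lemma Ck_hopf_cole k sigma w : (forall x, 0 < w x) -> Ck k w ->
  Ck k (fun x => - sigma ^+ 2 * ln (w x)).
Proof. by move=> w0 hw; apply: Ck_scale; exact: Ck_ln. Qed.

(** The second derivatives of the logarithm produce [- |grad w|^2 / w^2] with weight
    [sigma ^+ 4 / 2], which cancels the quadratic term of the Hamiltonian; this dictates the factor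
    [- sigma ^+ 2]. *)
Lemma cell_equation_hopf_cole sigma P V c w x : 0 < sigma -> Ck 2 w -> (forall x, 0 < w x) ->
  let v := fun x => - sigma ^+ 2 * ln (w x) in
  cell_equation sigma P (hamiltonian V) c (grad v x) (hessian v x) x =
  linear_operator sigma P V w x / w x - c.
Proof.
move=> s0 hw w0 v; have sn0 := lt0r_neq0 s0; have wn0 := lt0r_neq0 (w0 x).
have hln := Ck_ln w0 hw; have hi := Ck_inv w0 (CkW hw).
have pv i : partial i v = fun x => - sigma ^+ 2 * ((w x)^-1 * partial i w x).
  by rewrite (partial_scale i _ (CkW hln)) (partial_ln i w0 (CkW hw)).
have p2v i : partial i (partial i v) x = - sigma ^+ 2 * ((w x)^-1 * partial i (partial i w) x
    - ((w x)^-1 * partial i w x) ^+ 2).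
  rewrite pv (partial_scale i _ (Ck_mul hi (Ck_partial hw i))).
  rewrite (partial_mul i hi (Ck_partial hw i)) (partial_inv i w0 (CkW hw)).
  by move: (partial i (partial i w) x) (partial i w x) (w x)^-1 => A B C; ring.
pose Q := \sum_i ((w x)^-1 * partial i w x) ^+ 2.
have lv : laplacian v x = - sigma ^+ 2 * ((w x)^-1 * laplacian w x - Q).
  rewrite laplacianE laplacianE /Q mulr_sumr -sumrB mulr_sumr.
  by apply: eq_bigr => i _; rewrite p2v.
have gv : grad v x = (- sigma ^+ 2 / w x) *: grad w x.
  by apply/rowP => i; rewrite mxE [RHS]mxE mxE pv mulrA.
have Qd : Q = (w x)^-1 ^+ 2 * dot (grad w x) (grad w x).
  rewrite /Q /dot mulr_sumr; apply: eq_bigr => i _; rewrite mxE.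
  by move: (partial i w x) (w x)^-1 => A B; ring.
rewrite /cell_equation -/(laplacian v x) lv /hamiltonian gv dotDl dotDr dotDr !dotZl !dotZr Qd
  /linear_operator [dot (grad w x) P]dotC.
move: wn0; move: (dot P (grad w x)) (dot (grad w x) (grad w x)) (dot P P) (laplacian w x) (w x) (V x).
by move=> A B C D F G Fn0; field; rewrite Fn0.
Qed.

Lemma cell_equation_mono sigma P (H : 'rV[R]_n -> 'rV[R]_n -> R) c u phi x :
  grad u x = grad phi x -> laplacian u x <= laplacian phi x ->
  cell_equation sigma P H c (grad phi x) (hessian phi x) x <=
  cell_equation sigma P H c (grad u x) (hessian u x) x.
Proof.
have mono (t h A B : R) : 0 <= t -> A <= B -> - t * B + h - c <= - t * A + h - c.
  by move=> t0 AB; rewrite !lerD2r !mulNr lerN2 ler_wpM2l.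
move=> gE lE; rewrite /cell_equation gE; apply: mono lE.
by rewrite mulr_ge0 ?sqr_ge0 // invr_ge0.
Qed.

Lemma classical_viscosity_solution sigma P (H : 'rV[R]_n -> 'rV[R]_n -> R) c u : Ck 2 u ->
  (forall x, cell_equation sigma P H c (grad u x) (hessian u x) x = 0) ->
  viscosity_solution (cell_equation sigma P H c) u.
Proof.
move=> hu eq0; split; first exact: Ck_continuous hu.
- move=> phi x hphi xmax; rewrite -(eq0 x).
  have [g l] := local_max_grad_laplacian (Ck_sub hu hphi) xmax.
  rewrite (gradB _ (CkW hu) (CkW hphi)) in g; rewrite (laplacianB _ hu hphi) subr_le0 in l.
  by apply: cell_equation_mono l; apply/eqP; rewrite -subr_eq0 g.
- move=> phi x hphi xmin; rewrite -(eq0 x).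
  have [g l] := local_min_grad_laplacian (Ck_sub hu hphi) xmin.
  rewrite (gradB _ (CkW hu) (CkW hphi)) in g; rewrite (laplacianB _ hu hphi) subr_ge0 in l.
  by apply: cell_equation_mono l; apply/eqP; rewrite eq_sym -subr_eq0 g.
Qed.

Lemma hopf_cole_viscosity_solution sigma P V c w : 0 < sigma -> Ck 2 w -> (forall x, 0 < w x) ->
  (forall x, linear_operator sigma P V w x = c * w x) ->
  viscosity_solution (cell_equation sigma P (hamiltonian V) c) (fun x => - sigma ^+ 2 * ln (w x)).
Proof.
move=> s0 hw w0 eqw; apply: classical_viscosity_solution; first exact: Ck_hopf_cole.
move=> x; rewrite (cell_equation_hopf_cole P V c x s0 hw w0) eqw mulfK ?subrr //.
exact: lt0r_neq0.
Qed.

End HopfCole.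

(** * Regularity of [exp (- u / sigma^2)] and simplicity of the eigenvalue *)

Section Eigenfunction.
Context {R : realType} {n : nat}.
Variables (sigma : R) (P : 'rV[R]_n) (V : 'rV[R]_n -> R) (c : R).
Hypotheses (sigma0 : 0 < sigma) (smoothV : smooth V) (periodicV : Zperiodic V).
Implicit Types (u w phi psi f : 'rV[R]_n -> R) (x : 'rV[R]_n).

Let a := sigma ^+ 4 / 2.
Let b := sigma ^+ 2 *: P.
Let a0 : 0 < a. Proof. by rewrite divr_gt0 // exprn_gt0. Qed.

Let potential_ge x : 0 <= dot P P / 2.
Proof.
by rewrite divr_ge0 //; apply: sumr_ge0 => i _; rewrite -expr2 sqr_ge0.
Qed.

Lemma elliptic_linear_operator k w x :
  elliptic a k b w x = (k + V x + dot P P / 2) * w x - linear_operator sigma P V w x.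
Proof.
rewrite /elliptic /linear_operator /a /b dotZl.
by move: (laplacian w x) (dot P (grad w x)) (dot P P) (w x) => A B C D; ring.
Qed.

Section Existence.
Variable u : 'rV[R]_n -> R.
Hypotheses (periodicu : Zperiodic u)
  (viscu : viscosity_solution (cell_equation sigma P (hamiltonian V) c) u).

Let phi x := expR (- (u x / sigma ^+ 2)).

Let phi0 x : 0 < phi x. Proof. exact: expR_gt0. Qed.

Let uE x : u x = - sigma ^+ 2 * ln (phi x).
Proof. by rewrite /phi expRK mulrNN mulrC divfK // expf_neq0 // lt0r_neq0. Qed.

Let continuous_phi : continuous phi.
Proof.
move=> x; apply: continuous_comp; last exact: continuous_expR.
apply: continuousN; apply: continuousM; last exact: cst_continuous.
by have [cu _ _] := viscu; exact: cu.
Qed.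

Let periodic_phi : Zperiodic phi.
Proof. by move=> m x; rewrite /phi periodicu. Qed.

(** Since [u + sigma ^+ 2 * ln w = sigma ^+ 2 * ln (w / phi)], a maximum of [w / phi] is a maximum
    of [u] minus the test function; no regularity of [phi] beyond continuity enters. *)
Lemma viscosity_subsolution_max w x : Ck 2 w -> (forall y, 0 < w y) ->
  (forall y, w y / phi y <= w x / phi x) -> linear_operator sigma P V w x <= c * w x.
Proof.
move=> hw w0 wmax; have [_ sub _] := viscu.
have := sub _ x (Ck_hopf_cole sigma w0 hw).
rewrite (cell_equation_hopf_cole P V c x sigma0 hw w0) subr_le0 ler_pdivrMr //.
apply; apply: filterE => y.
have E z : u z - - sigma ^+ 2 * ln (w z) = sigma ^+ 2 * ln (w z / phi z).
  by rewrite ln_div ?posrE // uE; ring.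
by rewrite !E ler_pM2l ?exprn_gt0 // ler_ln ?posrE ?divr_gt0.
Qed.

Lemma viscosity_supersolution_min w x : Ck 2 w -> (forall y, 0 < w y) ->
  (forall y, w x / phi x <= w y / phi y) -> c * w x <= linear_operator sigma P V w x.
Proof.
move=> hw w0 wmin; have [_ _ sup] := viscu.
have := sup _ x (Ck_hopf_cole sigma w0 hw).
rewrite (cell_equation_hopf_cole P V c x sigma0 hw w0) subr_ge0 ler_pdivlMr //.
apply; apply: filterE => y.
have E z : u z - - sigma ^+ 2 * ln (w z) = sigma ^+ 2 * ln (w z / phi z).
  by rewrite ln_div ?posrE // uE; ring.
by rewrite !E ler_pM2l ?exprn_gt0 // ler_ln ?posrE ?divr_gt0.
Qed.

(** At a maximum of [w / phi], [elliptic w = q * w + c * w - L w >= q * w], while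
    [elliptic w <= q * phi + d]. As [q >= 1], [w - phi <= d] there, hence
    [w / phi <= 1 + d / min phi] everywhere; the minimum is symmetric. *)
Lemma approx_sol_exp k : 0 < k -> (forall x, 1 <= k + V x + dot P P / 2 - c) ->
  approx_sol a k b phi (fun x => (k + V x + dot P P / 2 - c) * phi x).
Proof.
move=> k0 q1 e e0.
pose q x := k + V x + dot P P / 2 - c.
have [xm hm] := Zperiodic_min continuous_phi periodic_phi.
have [xM hM] := Zperiodic_max continuous_phi periodic_phi.
pose m0 := phi xm; pose M0 := phi xM.
have m00 : 0 < m0 by exact: phi0.
have M00 : 0 < M0 by exact: phi0.
(* The three bounds serve the right-hand side, the positivity of [w] (through
   [elliptic w >= m0 / 2]), and the estimate [d / m0 * phi <= e]. *)
pose d := Num.min e (Num.min (m0 / 2) (e * m0 / M0)).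
have d0 : 0 < d by rewrite !lt_min e0 !divr_gt0 // mulr_gt0.
have de : d <= e by rewrite ge_min lexx.
have dm : d <= m0 / 2 by rewrite !ge_min lexx /= orbT.
have dM : d <= e * m0 / M0 by rewrite !ge_min lexx !orbT.
have cq : continuous q.
  have hV := smoothV 0.
  have hc (r : R) : Ck 0 (fun _ : 'rV[R]_n => r) by exact: Ck_cst.
  exact: (Ck_continuous (Ck_sub (Ck_add (Ck_add (hc k) hV) (hc (dot P P / 2))) (hc c))).
have cg : continuous (fun x => q x * phi x).
  by move=> x; apply: continuousM; [exact: cq|exact: continuous_phi].
have pg : Zperiodic (fun x => q x * phi x).
  by move=> m x; rewrite /q periodicV periodic_phi.
have [w [hw pw gw]] := elliptic_dense b a0 k0 cg pg d0.
have w0 x : 0 < w x.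
  have h : forall y, m0 / 2 <= elliptic a k b w y.
    move=> y; have := gw y; rewrite ler_norml => /andP[_ h1].
    have h2 : m0 <= q y * phi y by apply: le_trans (hm y) _; rewrite ler_peMl ?q1 // ltW.
    by move: h1; move: (elliptic a k b w y) => A h1; lra.
  have := elliptic_lower_bound a0 k0 hw pw h x.
  have m2 : 0 < m0 / 2 by rewrite divr_gt0.
  by move=> /(lt_le_trans m2); rewrite pmulr_rgt0.
have hphi : Ck 0 phi by split; first exact: continuous_phi.
have cr := Ck_continuous (Ck_mul (Ck_le (leq0n 2) hw) (Ck_inv phi0 hphi)).
have pr : Zperiodic (fun x => w x / phi x) by move=> m x; rewrite pw periodic_phi.
have [x1 h1] := Zperiodic_max cr pr.
have [x2 h2] := Zperiodic_min cr pr.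
pose r := d / m0.
have r0 : 0 <= r by rewrite divr_ge0 // ltW.
have rphi x : d <= r * phi x.
  by rewrite /r mulrAC ler_pdivlMr // ler_pM2l // hm.
have qE x : (k + V x + dot P P / 2) * w x = q x * w x + c * w x by rewrite /q; ring.
have up : w x1 / phi x1 <= 1 + r.
  have := viscosity_subsolution_max hw w0 h1.
  have := gw x1; rewrite ler_norml => /andP[g1 _]; move: g1.
  rewrite elliptic_linear_operator qE => g1 g2.
  have g3 : q x1 * (w x1 - phi x1) <= d.
    by rewrite mulrBr; move: (linear_operator _ _ _ _ _) g1 g2 => A g1 g2; lra.
  rewrite ler_pdivrMr // mulrDl mul1r -lerBlDl.
  apply: le_trans (rphi x1); have [wp|/ltW wp] := leP (w x1 - phi x1) 0.
    exact: le_trans wp (ltW d0).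
  by apply: le_trans g3; rewrite ler_peMl // q1.
have lo : 1 - r <= w x2 / phi x2.
  have := viscosity_supersolution_min hw w0 h2.
  have := gw x2; rewrite ler_norml => /andP[_ g1]; move: g1.
  rewrite elliptic_linear_operator qE => g1 g2.
  have g3 : q x2 * (phi x2 - w x2) <= d.
    by rewrite mulrBr; move: (linear_operator _ _ _ _ _) g1 g2 => A g1 g2; lra.
  rewrite ler_pdivlMr // mulrBl mul1r lerBlDl -lerBlDr.
  apply: le_trans (rphi x2); have [wp|/ltW wp] := leP (phi x2 - w x2) 0.
    exact: le_trans wp (ltW d0).
  by apply: le_trans g3; rewrite ler_peMl // q1.
exists w; split=> // x; last exact: le_trans (gw x) de.
have rM : r * phi x <= e.
  apply: (@le_trans _ _ (r * M0)); first by rewrite ler_wpM2l // hM.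
  by rewrite /r mulrAC ler_pdivrMr // -ler_pdivlMr.
have u1 : w x <= (1 + r) * phi x by rewrite -ler_pdivrMr // (le_trans (h1 x)).
have u2 : (1 - r) * phi x <= w x by rewrite -ler_pdivlMr // (le_trans lo).
by rewrite ler_norml; apply/andP; split; lra.
Qed.

Lemma viscosity_solution_eigenfunction : exists phi,
  [/\ Ck 2 phi, Zperiodic phi, forall x, 0 < phi x
    & forall x, linear_operator sigma P V phi x = c * phi x].
Proof.
have [M M0 VM] := Zperiodic_bounded (Ck_continuous (smoothV 0)) periodicV.
pose k := 1 + M + `|c|.
have k0 : 0 < k by rewrite ltr_pwDl ?addr_gt0.
have q1 x : 1 <= k + V x + dot P P / 2 - c.
  have := VM x; rewrite ler_norml => /andP[h1 _]; have h2 := ler_norm c.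
  have h3 := potential_ge x; rewrite /k.
  by move: (dot P P / 2) h3 => A h3; lra.
have s := approx_sol_exp k0 q1.
have hq : Ck 1 (fun x => k + V x + dot P P / 2 - c).
  have hc (r : R) : Ck 1 (fun _ : 'rV[R]_n => r) by exact: Ck_cst.
  exact: (Ck_sub (Ck_add (Ck_add (hc k) (smoothV 1)) (hc (dot P P / 2))) (hc c)).
have pq : Zperiodic (fun x => k + V x + dot P P / 2 - c) by move=> m x; rewrite periodicV.
have hphi : Ck 2 phi := approx_sol_Ck2 a0 k0 hq pq periodic_phi s.
(* Now that [phi] is C^2, take [w = phi]: the ratio is constantly 1, so every point is both a
   maximum and a minimum. *)
exists phi; split=> // x; apply/eqP; rewrite eq_le; apply/andP; split.
  by apply: viscosity_subsolution_max => // y; rewrite !divff // lt0r_neq0.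
by apply: viscosity_supersolution_min => // y; rewrite !divff // lt0r_neq0.
Qed.

End Existence.

Lemma eigenfunctions_proportional phi psi :
  Ck 2 phi -> Zperiodic phi -> (forall x, 0 < phi x) ->
  (forall x, linear_operator sigma P V phi x = c * phi x) ->
  Ck 2 psi -> Zperiodic psi -> (forall x, 0 < psi x) ->
  (forall x, linear_operator sigma P V psi x = c * psi x) ->
  exists r : R, forall x, psi x = r * phi x.
Proof.
move=> hphi pphi phi0 ephi hpsi ppsi psi0 epsi.
have [M M0 VM] := Zperiodic_bounded (Ck_continuous (smoothV 0)) periodicV.
have cr := Ck_continuous (Ck_mul hpsi (Ck_inv phi0 hphi)).
have pr : Zperiodic (fun x => psi x / phi x) by move=> m x; rewrite pphi ppsi.
have [x0 h0] := Zperiodic_min cr pr.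
pose r := psi x0 / phi x0; exists r.
pose chi x := psi x - r * phi x.
have hr := Ck_scale r hphi.
have chi0 x : 0 <= chi x by rewrite subr_ge0 -ler_pdivlMr // h0.
have chix0 : chi x0 = 0 by rewrite /chi /r divfK ?subrr // lt0r_neq0.
(* [chi] satisfies [a * laplacian chi - dot b (grad chi) = (c - V - dot P P / 2) * chi]; as
   [chi >= 0], an upper bound [K] of the coefficient suffices. *)
pose K := `|c| + M.
have K0 : 0 <= K by rewrite addr_ge0 // ltW.
have H := @strong_minimum R n a K b a0 K0 chi x0 (Ck_sub hpsi hr) chi0 chix0.
move=> x; apply/eqP; rewrite -subr_eq0; apply/eqP; apply: H => y.
have := epsi y; have := ephi y; have := chi0 y; have := VM y.
rewrite (laplacianB _ hpsi hr) (gradB _ (CkW hpsi) (CkW hr)) (laplacianZ _ _ hphi) (gradZ _ _ (CkW hphi)).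
rewrite -[- (r *: grad phi y)]scaleN1r dotDr !dotZr /b !dotZl /linear_operator -/a.
rewrite ler_norml /chi => /andP[V1 _].
move: (laplacian psi y) (laplacian phi y) (dot P (grad psi y)) (dot P (grad phi y)) (psi y) (phi y).
move=> A B C D F G FG e1 e2.
have -> : a * (A - r * B) - (sigma ^+ 2 * C + -1 * (r * (sigma ^+ 2 * D))) =
    (c - V y - dot P P / 2) * (F - r * G).
  rewrite (_ : a * (A - r * B) - (sigma ^+ 2 * C + -1 * (r * (sigma ^+ 2 * D))) =
    (a * A - sigma ^+ 2 * C + (V y + dot P P / 2) * F)
    - r * (a * B - sigma ^+ 2 * D + (V y + dot P P / 2) * G)
    - (V y + dot P P / 2) * (F - r * G)); last by ring.
  by rewrite e1 e2; ring.
apply: ler_wpM2r => //; have h2 := ler_norm c; have h3 := potential_ge y; rewrite /K.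
by move: (dot P P / 2) h3 => Q h3; lra.
Qed.

End Eigenfunction.
Unset Implicit Arguments.

Theorem proposition6 (R : realType) (n : nat) (sigma : R) (P : 'rV[R]_n)
    (V : 'rV[R]_n -> R) (Hbar : R)
    (sigma_gt0 : 0 < sigma) (smoothV : smooth V) (periodicV : Zperiodic V)
    (HbarP : is_effective_hamiltonian sigma P (hamiltonian V) Hbar) :
  (forall psi : 'rV[R]_n -> R, Ck 2 psi -> forall x : 'rV[R]_n,
     twisted_operator sigma P V psi x =
       sigma ^+ 4 / 2 * laplacian psi x - sigma ^+ 2 * dot P (grad psi x)
       + (V x + dot P P / 2) * psi x) /\
  is_principal_eigenvalue (twisted_operator sigma P V) Hbar.
Proof.
have eigE mu phi : positive_eigenfunction (twisted_operator sigma P V) mu phi ->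
    [/\ Ck 2 phi, Zperiodic phi, forall x, 0 < phi x
      & forall x, linear_operator sigma P V phi x = mu * phi x].
  by move=> [h1 h2 h3 h4]; split=> // x; rewrite -twisted_operatorE.
have [[u [pu vu]] uniq] := HbarP.
split; first by move=> psi hpsi x; exact: twisted_operatorE.
split; first split.
- have [phi [h1 h2 h3 h4]] :=
    viscosity_solution_eigenfunction sigma_gt0 smoothV periodicV pu vu.
  by exists phi; split=> // x; rewrite twisted_operatorE.
- move=> mu [phi /eigE[h1 h2 h3 h4]]; apply: uniq.
  exists (fun x => - sigma ^+ 2 * ln (phi x)); split; first by move=> m x; rewrite h2.
  exact: hopf_cole_viscosity_solution.
- move=> phi psi /eigE[h1 h2 h3 h4] /eigE[k1 k2 k3 k4].
  exact: (eigenfunctions_proportional sigma_gt0 smoothV periodicV h1 h2 h3 h4 k1 k2 k3 k4).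
Qed.
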